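(* Let $\phi:\mathbb{N}\to\mathbb{R}^+$ be a non-decreasing function, and let \[ E'(\phi):=\Big\{x\in[0,1):\ \exists\, 1\le k\neq l\le n \text{ with } a'_k(x)\ge\phi(n),\ a'_l(x)\ge\phi(n)\ \text{for infinitely many } n\in\mathbb{N}\Big\}. \] Then, with $\mathcal{L}$ denoting Lebesgue measure, \[ \mathcal{L}(E'(\phi))=\begin{cases}0, & \text{if } \sum_{n\ge1}\dfrac{n}{\phi^2(n)\log^2\phi(n)}<\infty,\\[2mm] 1, & \text{if } \sum_{n\ge1}\dfrac{n}{\phi^2(n)\log^2\phi(n)}=\infty.\end{cases} \]
   Context: Every $x\in[0,1)$ has a continued fraction expansion $x=[a_1(x),a_2(x),\dots]=\cfrac{1}{a_1(x)+\cfrac{1}{a_2(x)+\cdots}}$, where $a_1(x)=\lfloor 1/x\rfloor$ and $a_k(x)=a_1(T^{k-1}x)$ for $k\ge2$, with $T$ the Gauss map $T(x)=\{1/x\}$ for $x\neq0$, $T(0)=0$. The $a_k(x)$ are the partial quotients. For each $i$, $a'_i(x)$ denotes $a_i(x)$ if $a_i(x)$ is a prime number and $0$ otherwise. *)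

(* Defs.v *)
From HB Require Import structures.
From mathcomp Require Export all_boot all_order all_algebra.
From mathcomp Require Export all_classical all_reals all_analysis.

Set Implicit Arguments.
Unset Strict Implicit.
Unset Printing Implicit Defensive.

Import Order.TTheory GRing.Theory Num.Theory.
Import numFieldNormedType.Exports.

Local Open Scope classical_set_scope.
Local Open Scope ring_scope.

Section continued_fractions.
Variable R : realType.
Implicit Types (x : R) (k : nat).

Definition gauss_map x : R :=
  if x == 0 then 0 else x^-1 - (Num.floor x^-1)%:~R.

(* Indices start at k = 1. Since 0^-1 = 0, the value is 0 once the (finite)
   expansion of a rational x has terminated; 0 is not prime, so such an index
   never contributes to primed_quotient. *)
Definition partial_quotient k x : nat :=
  Num.truncn (iter k.-1 gauss_map x)^-1.

Definition primed_quotient k x : nat :=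
  if prime (partial_quotient k x) then partial_quotient k x else 0%N.

Definition two_large_prime_quotients (phi : nat -> R) : set R :=
  [set x | 0 <= x < 1 /\
    infinite_set [set n : nat | exists k l : nat,
      [/\ (1 <= k <= n)%N, (1 <= l <= n)%N, k <> l,
          phi n <= (primed_quotient k x)%:R &
          phi n <= (primed_quotient l x)%:R]]].

End continued_fractions.

Section series.
Variable R : realType.
Implicit Type phi : nat -> R.
Local Open Scope ereal_scope.

(* n / (phi(n)^2 log^2 phi(n)); extended-real division has 0^-1 = +oo, so for
   n >= 1 the term is +oo when phi n = 1. *)
Definition series_term phi (n : nat) : \bar R :=
  n%:R%:E / ((phi n) ^+ 2 * (ln (phi n)) ^+ 2)%:E.

(* The terms with phi n = 1 are undefined. If there are finitely many of them
   (e.g. phi n = n at n = 1) they are to be ignored; if phi is eventually 1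
   the series counts as divergent. Hence convergence and divergence refer to
   the tails. When no phi n is 1 they reduce to the full sum over n >= 1, see
   series_convergentE and series_divergentE. *)
Definition series_convergent phi : Prop :=
  exists2 N : nat, (0 < N)%N & \sum_(N <= n <oo) series_term phi n < +oo.

Definition series_divergent phi : Prop :=
  forall N : nat, (0 < N)%N -> \sum_(N <= n <oo) series_term phi n = +oo.

Lemma series_term_ge0 phi n : 0 <= series_term phi n.
Proof.
rewrite /series_term mule_ge0 ?lee_fin ?ler0n// inver; case: ifP => _.
  exact: leey.
by rewrite lee_fin invr_ge0 mulr_ge0 ?sqr_ge0.
Qed.

Lemma series_termE phi n : (0 < phi n)%R -> phi n <> 1%R ->
  series_term phi n = (n%:R / (phi n ^+ 2 * ln (phi n) ^+ 2))%R%:E.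
Proof.
move=> phi0 /eqP phi1; rewrite /series_term inver mulf_eq0 !expf_eq0 /=.
by rewrite gt_eqF//= ln_eq0// (negPf phi1) -EFinM.
Qed.

Lemma series_divergentP phi : series_divergent phi <-> ~ series_convergent phi.
Proof.
split=> [div [N N0]|ncvg N N0]; first by rewrite div ?ltxx.
apply/eqP; rewrite -leye_eq leNgt; apply/negP => cvgN; apply: ncvg.
by exists N.
Qed.

Lemma series_convergentE phi :
    (forall n, (0 < n)%N -> (0 < phi n)%R) ->
    (forall n, (0 < n)%N -> phi n <> 1%R) ->
  series_convergent phi <->
  \sum_(1 <= n <oo) (n%:R / (phi n ^+ 2 * ln (phi n) ^+ 2))%R%:E < +oo.
Proof.
move=> phi0 phi1.
have -> : \sum_(1 <= n <oo) (n%:R / (phi n ^+ 2 * ln (phi n) ^+ 2))%R%:E =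
          \sum_(1 <= n <oo) series_term phi n.
  apply/congr_lim/funext => m; apply: eq_big_nat => n /andP[n0 _].
  by rewrite series_termE//; [exact: phi0|exact: phi1].
split=> [[[//|N] _ cvgN]|]; last by exists 1%N.
rewrite (nneseries_split 1 N); last by move=> *; exact: series_term_ge0.
rewrite add1n lte_add_pinfty// big_nat; apply/lte_sum_pinfty => n /andP[n0 _].
by rewrite series_termE ?ltry//; [exact: phi0|exact: phi1].
Qed.

Lemma series_divergentE phi :
    (forall n, (0 < n)%N -> (0 < phi n)%R) ->
    (forall n, (0 < n)%N -> phi n <> 1%R) ->
  series_divergent phi <->
  \sum_(1 <= n <oo) (n%:R / (phi n ^+ 2 * ln (phi n) ^+ 2))%R%:E = +oo.
Proof.
move=> phi0 phi1; rewrite series_divergentP series_convergentE//.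
by split=> [/negP|->]; rewrite ?ltxx// -leNgt leye_eq => /eqP.
Qed.

End series.

(* Main.v *)
Require Import Defs.
From mathcomp Require Import zify ring lra.

Set Implicit Arguments.
Unset Strict Implicit.
Unset Printing Implicit Defensive.

Import Order.TTheory GRing.Theory Num.Theory.
Import numFieldNormedType.Exports.

(** Given the first n partial quotients, the next one equals b with conditional
    probability between 1/(3 b^2) and 2/b^2.  Chebyshev's estimates turn this
    into: the next one is a prime >= t with conditional probability comparable
    to 1/(t log t), uniformly in the past.  Put v_j = 16^j / (phi(4^j) log
    phi(4^j))^2; by Cauchy condensation the sum of the v_j converges iff the
    given series does.  If it converges, two large primes among the first
    4^(j+1) quotients have probability O(v_j), and Borel-Cantelli applies.  If
    it diverges, the blocks (4^j, 2 4^j] and (2 4^j, 3 4^j] both contain a prime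
    >= phi(4^(j+1)) with probability at least a constant times min(1, v_(j+1)),
    whatever happened before; hence almost surely this happens infinitely often,
    and no zero-one law is needed. *)

(** * Chebyshev bounds *)

(** The obstacle is the dependence between partial quotients. Every estimate is therefore put in
    product form: for each event [B] determined by the earlier digits, [B] together with a hit has
    probability at most (or at least) a constant times that of [B]. Such bounds multiply along the
    digits as under independence. The constant is uniform because appending [b] to a word shrinks
    its cylinder by a factor that depends on the past only through [q_(n-1) / q_n], a number in
    [0, 1]. Points whose expansion terminates produce the digit 0; they form a countable set, so
    words containing 0 have null cylinders. Base 4 leaves room for two blocks of length 4^j after
    the digit 4^j: they end at 3 4^j, before 4^(j+1). Hence the event of index j is settled before
    the blocks of index j + 1 begin, and the single value n = 4^(j+1) witnesses both hits. *)

Definition prime_count (N : nat) : nat := \sum_(0 <= p < N.+1 | prime p) 1.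

Lemma prod_primes_dvdn (s : seq nat) (n : nat) :
  uniq s -> {in s, forall p, prime p && (p %| n)} -> \prod_(p <- s) p %| n.
Proof.
elim: s => [|p s IH] /=; first by rewrite big_nil dvd1n.
move=> /andP[ps us] h; rewrite big_cons Gauss_dvd.
  have /andP[_ ->] := h p (mem_head _ _).
  by apply: IH => // q qs; apply: h; rewrite inE qs orbT.
rewrite coprime_sym; have /andP[pp _] := h p (mem_head _ _).
rewrite big_seq; apply: (big_ind (fun m => coprime m p)).
- exact: coprime1n.
- by move=> a b ca cb; rewrite coprimeMl ca.
- move=> q qs; have /andP[qp _] : prime q && (q %| n) by apply: h;
  rewrite inE qs orbT.
  rewrite prime_coprime// dvdn_prime2//; apply: contra ps => /eqP <-.
  exact: qs.
Qed.

Lemma prime_dvd_fact p n : prime p -> p %| n`! -> p <= n.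
Proof.
move=> pp; elim: n => [|n IH]; first by rewrite Euclid_dvd1.
by rewrite factS Euclid_dvdM// => /orP[/dvdn_leq->//|/IH/leqW].
Qed.

(** The two equal middle coefficients both occur in the expansion of [(1 + 1) ^ (2 m + 1)], so twice
    one of them is at most [2 * 4 ^ m]. *)
Lemma bin_odd_mid_le m : 'C(m.*2.+1, m) <= 4 ^ m.
Proof.
rewrite -(@leq_pmul2l 2)//.
have -> : 2 * 4 ^ m = 2 ^ m.*2.+1 by rewrite expnS -mul2n expnM.
have Dm : (inord m.+1 : 'I_m.*2.+2) != inord m.
  by apply/eqP => /(congr1 val); rewrite /= !inordK; lia.
rewrite (expnDn 1 1) (bigD1 (inord m))//= (bigD1 (inord m.+1))//= !inordK;
  try lia.
rewrite !exp1n !muln1 -(@bin_sub _ m.+1); last by lia.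
have -> : m.*2.+1 - m.+1 = m by lia.
by rewrite addnA mul2n -addnn leq_addr.
Qed.

(** Erdős's argument, by strong induction: an even [N > 2] is not prime and reduces to [N - 1]; for
    [N = 2 m + 1] the primes in [(m + 1, 2 m + 1]] divide the binomial coefficient [C(2 m + 1, m)],
    which is at most [4 ^ m]. *)
Lemma primorial_le N : \prod_(0 <= p < N.+1 | prime p) p <= 4 ^ N.
Proof.
have [n] := ubnP N; elim: n N => // n IH N /ltnSE leNn.
have [N2|N2] := leqP N 2.
  by case: N N2 {leNn} => [|[|[|]]]// _; rewrite unlock.
case oN: (odd N); last first.
  rewrite big_mkcond big_nat_recr//= -big_mkcond/=.
  have -> : prime N = false.
    by apply/negP => /even_prime []; rewrite ?oN// => ?; lia.
  rewrite muln1; have -> : N = N.-1.+1 by lia.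
  by apply: leq_trans (IH _ _) _; rewrite ?leq_exp2l//; lia.
have [m Nm] : exists m, N = m.*2.+1 by exists N./2; lia.
rewrite {}Nm in leNn N2 oN *.
rewrite (big_cat_nat _ (n := m.+2))//=; last by lia.
apply: (@leq_trans (4 ^ m.+1 * 4 ^ m)); last by rewrite -expnD leq_exp2l//; lia.
apply: leq_mul; first by apply: IH; lia.
apply: leq_trans (bin_odd_mid_le m).
apply: dvdn_leq; first by rewrite bin_gt0; lia.
rewrite -big_filter; apply: prod_primes_dvdn => [|p].
  by rewrite filter_uniq ?iota_uniq.
rewrite mem_filter mem_index_iota => /andP[pp pr]; rewrite pp /=.
have : p %| (m.*2.+1)`! by rewrite dvdn_fact; lia.
rewrite -(@bin_fact _ m); last by lia.
rewrite !Euclid_dvdM// => /or3P[//|/(prime_dvd_fact pp)|/(prime_dvd_fact pp)];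
  lia.
Qed.

Lemma bin_mid_ge n : 2 ^ n <= 'C(n.*2, n).
Proof.
elim: n => // n IH; rewrite doubleS binS expnS mul2n -addnn.
apply: leq_add; apply: leq_trans IH _; first by rewrite binS leq_addl.
by case: n => // n; rewrite [leqRHS]binS leq_addr.
Qed.

(** Legendre's formula with a common summation range, so that [n!] and [(2 n)!] can be compared term
    by term. *)
Lemma logn_fact_widen p n M : prime p -> n <= M ->
  logn p n`! = \sum_(1 <= k < M.+1) n %/ p ^ k.
Proof.
move=> pp nM; rewrite logn_fact// [RHS](big_cat_nat _ (n := n.+1))//=.
rewrite [X in _ + X]big1_seq ?addn0// => k; rewrite mem_index_iota => nk.
rewrite divn_small//; apply: leq_trans (ltn_expl _ (prime_gt1 pp)); lia.
Qed.

(** In Legendre's formula each power [p ^ k] contributes [floor (2 n / p^k) - 2 floor (n / p^k)],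
    which is 0 or 1, and 0 once [p ^ k > 2 n]; so the exponent is at most the integer logarithm of
    [2 n] to base [p]. *)
Lemma logn_bin_mid p n : 0 < n -> prime p -> p ^ logn p 'C(n.*2, n) <= n.*2.
Proof.
move=> n0 pp; have p1 := prime_gt1 pp.
apply: leq_trans (trunc_logP p1 (_ : 0 < n.*2)); last by lia.
rewrite leq_exp2l//; set t := trunc_log _ _.
have n2 : n.*2 - n = n by lia.
have : logn p (n.*2)`! = logn p 'C(n.*2, n) + (logn p n`!).*2.
  rewrite -(@bin_fact _ n); last by lia.
  by rewrite n2 !lognM ?muln_gt0 ?fact_gt0 ?bin_gt0 ?addnn//; lia.
rewrite !(@logn_fact_widen _ _ n.*2)//; last by lia.
suff : \sum_(1 <= k < n.*2.+1) n.*2 %/ p ^ k <=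
       (\sum_(1 <= k < n.*2.+1) n %/ p ^ k).*2 + t by lia.
have sumt M : \sum_(1 <= k < M.+1) (k <= t) = minn M t.
  elim: M => [|M IH]; first by rewrite big_geq// min0n.
  by rewrite big_nat_recr//= IH; case: leqP => ?; lia.
apply: (@leq_trans ((\sum_(1 <= k < n.*2.+1) n %/ p ^ k).*2 +
                    \sum_(1 <= k < n.*2.+1) (k <= t))); last first.
  by rewrite leq_add2l sumt geq_minr.
rewrite -[X in _ <= X + _]mul2n big_distrr -big_split/= !big_seq;
  apply: leq_sum => k.
rewrite mem_index_iota => kr; have [kt|tk] := leqP k t; last first.
  rewrite divn_small//; apply: leq_trans (trunc_log_ltn _ p1) _.
  by rewrite leq_exp2l.
have q0 : 0 < p ^ k by rewrite expn_gt0; lia.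
rewrite -ltnS ltn_divLR//; have := ltn_ceil n q0; nia.
Qed.

(** The central binomial coefficient is at least [2 ^ n] and is a product of prime powers, one for
    each of its prime divisors, all of them at most [2 n]. *)
Lemma prime_count_ge n : 0 < n -> 2 ^ n <= n.*2 ^ prime_count n.*2.
Proof.
move=> n0; apply: leq_trans (bin_mid_ge n) _.
have C0 : 0 < 'C(n.*2, n) by rewrite bin_gt0; lia.
rewrite {1}(prod_prime_decomp C0) prime_decompE big_map /=.
apply: (@leq_trans (\prod_(p <- primes 'C(n.*2, n)) n.*2)).
  rewrite !big_seq; apply: leq_prod => p; rewrite mem_primes => /andP[pp _].
  exact: logn_bin_mid.
rewrite big_const_seq count_predT iter_muln_1 leq_exp2l; last by lia.
rewrite /prime_count -big_filter sum1_size.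
apply: uniq_leq_size; first exact: primes_uniq.
move=> p; rewrite mem_primes mem_filter mem_index_iota => /and3P[pp _ pC].
rewrite pp /= ltnS (@prime_dvd_fact p n.*2)//.
by rewrite -(@bin_fact _ n) ?dvdn_mulr//; lia.
Qed.

Local Open Scope classical_set_scope.
Local Open Scope ring_scope.

Section prime_sums.
Variable R : realType.
Implicit Types (x : R) (n N M : nat).

Lemma ln2_ge_half : 2^-1 <= ln 2 :> R.
Proof.
have := @le_ln1Dx R (- 2^-1); have -> : 1 + - 2^-1 = 2^-1 :> R by field.
rewrite lnV ?posrE//; lra.
Qed.

Lemma lnS_sub_ln n : n.+1%:R * (ln n.+2%:R - ln n.+1%:R) <= 1 :> R.
Proof.
have := @le_ln1Dx R (n.+1%:R^-1).
have n0 : 0 < n.+1%:R :> R by rewrite ltr0n.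
have -> : 1 + n.+1%:R^-1 = n.+2%:R / n.+1%:R :> R.
  by rewrite -(natr1 n.+1); field; rewrite gt_eqF.
rewrite ln_div ?posrE ?ltr0n// => h.
rewrite mulrC -ler_pdivlMr// mul1r; apply: h.
by apply: (@lt_trans _ _ 0); rewrite ?invr_gt0//; lra.
Qed.

(** This is [N^N / N! <= e^N] in logarithmic form. Passing from [N] to [N + 1] adds
    [N ln ((N + 1) / N) <= 1]. *)
Lemma sum_ln_ratio_le N :
  \sum_(1 <= m < N.+1) (ln N%:R - ln m%:R) <= N%:R :> R.
Proof.
case: N => [|N]; first by rewrite big_geq.
elim: N => [|N IH]; first by rewrite big_nat1 subrr.
rewrite big_nat_recr//= subrr addr0.
have -> : \sum_(1 <= m < N.+2) (ln N.+2%:R - ln m%:R) =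
  \sum_(1 <= m < N.+2) (ln N.+1%:R - ln m%:R) +
    N.+1%:R * (ln N.+2%:R - ln N.+1%:R) :> R.
  have -> : N.+1%:R * (ln N.+2%:R - ln N.+1%:R) =
    \sum_(1 <= m < N.+2) (ln N.+2%:R - ln N.+1%:R) :> R.
    by rewrite sumr_const_nat subn1 mulr_natl.
  rewrite -big_split/=; by apply: eq_bigr => i _; ring.
by rewrite -[leRHS]natr1 lerD// lnS_sub_ln.
Qed.

Lemma ln_prod_prime N :
  ln (\prod_(0 <= p < N | prime p) p)%:R =
  \sum_(0 <= p < N | prime p) ln p%:R :> R.
Proof.
elim: N => [|N IH]; first by rewrite !big_geq// ln1.
rewrite !(@big_mkcond _ _ _ _ _ prime) !big_nat_recr//= -!big_mkcond/=.
case: ifP => pN; last by rewrite muln1 addr0.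
by rewrite natrM lnM ?IH// posrE ltr0n ?(prime_gt0 pN)// prodn_cond_gt0// =>
  p /prime_gt0.
Qed.

(* [pi(N) ln N = theta(N) + sum_(p <= N) ln (N / p)]; the second sum, extended
   to all integers up to [N], is at most [N]. *)
Lemma prime_count_ub N : (0 < N)%N ->
  (prime_count N)%:R * ln N%:R <= 4 * ln 2 * N%:R :> R.
Proof.
move=> N0; have N0' : 1 <= N%:R :> R by rewrite ler1n.
have theta : \sum_(0 <= p < N.+1 | prime p) ln p%:R <= 2 * ln 2 * N%:R :> R.
  rewrite -ln_prod_prime.
  have -> : 2 * ln 2 * N%:R = ln (4 ^ N)%:R :> R.
    rewrite natrX lnXn// -[RHS]mulr_natr; congr (_ * _).
    by rewrite mulr_natl -lnXn// -natrX.
  rewrite ler_ln ?posrE ?ltr0n ?expn_gt0 ?ler_nat ?primorial_le//.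
  by rewrite prodn_cond_gt0// => p /prime_gt0.
have rest : \sum_(0 <= p < N.+1 | prime p) (ln N%:R - ln p%:R) <= N%:R :> R.
  apply: le_trans (sum_ln_ratio_le N).
  rewrite [leLHS]big_mkcond big_ltn//= add0r !big_seq; apply: ler_sum => p.
  rewrite mem_index_iota => pr; case: ifP => // _.
  by rewrite subr_ge0 ler_ln ?posrE ?ltr0n ?ler_nat//; lia.
rewrite /prime_count natr_sum mulr_suml.
have -> : \sum_(0 <= p < N.+1 | prime p) 1%:R * ln N%:R =
   \sum_(0 <= p < N.+1 | prime p) ln p%:R +
   \sum_(0 <= p < N.+1 | prime p) (ln N%:R - ln p%:R) :> R.
  by rewrite -big_split/=; apply: eq_bigr => p _; ring.
apply: le_trans (lerD theta rest) _; have := ln2_ge_half; nra.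
Qed.

Lemma prime_count_lb n : (0 < n)%N ->
  n%:R * ln 2 <= (prime_count n.*2)%:R * ln n.*2%:R :> R.
Proof.
move=> n0; have n2 : (0 < n.*2)%N by lia.
have : ln (2 ^ n)%:R <= ln (n.*2 ^ prime_count n.*2)%:R :> R.
  by rewrite ler_ln ?posrE ?ltr0n ?expn_gt0 ?n2// ler_nat prime_count_ge.
by rewrite !natrX !lnXn ?ltr0n// -[leLHS]mulr_natl -[leRHS]mulr_natl.
Qed.

Lemma sum_prime_const (c : R) a b : (a <= b)%N ->
  \sum_(a.+1 <= p < b.+1 | prime p) c =
  ((prime_count b)%:R - (prime_count a)%:R) * c.
Proof.
move=> ab; rewrite /prime_count !natr_sum.
rewrite (big_cat_nat _ (n := a.+1) (m := 0) (p := b.+1))//=.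
rewrite [X in X - _]addrC addrK mulr_suml; apply: eq_bigr => *;
  by rewrite mul1r.
Qed.

(** Each term is at most [1 / n^2], and there are at most [pi(2 n)] of them, where
    [pi(2 n) ln n <= 4 ln 2 * 2 n <= 8 n]. *)
Lemma sum_prime_sq_double n : (1 < n)%N ->
  \sum_(n.+1 <= p < n.*2.+1 | prime p) (p%:R ^+ 2)^-1 <=
  8 / (n%:R * ln n%:R) :> R.
Proof.
move=> n1; have n1' : 1 < n%:R :> R by rewrite ltr1n.
have n0 : 0 < n%:R :> R by lra.
have ln0 : 0 < ln n%:R :> R by rewrite ln_gt0.
apply: (@le_trans _ _ (\sum_(n.+1 <= p < n.*2.+1 | prime p) (n%:R ^+ 2)^-1)).
  rewrite big_seq_cond [leRHS]big_seq_cond; apply: ler_sum => p.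
  rewrite mem_index_iota => /andP[pr _].
  by rewrite lef_pV2 ?posrE ?exprn_gt0 ?ltr0n ?lerXn2r ?nnegrE ?ler0n ?ler_nat//; lia.
rewrite sum_prime_const; last by lia.
have c0 : 0 <= (prime_count n)%:R :> R by [].
have := @prime_count_ub n.*2 ltac:(lia).
have -> : n.*2%:R = 2 * n%:R :> R by rewrite -mul2n natrM.
rewrite lnM ?posrE// => h.
rewrite ler_pdivlMr ?mulr_gt0// mulrAC ler_pdivrMr ?exprn_gt0//.
have l2 := ln2_ge_half.
have l2' : ln 2 <= 1 :> R.
  by have := @le_ln1Dx R 1; rewrite (_ : 1 + 1 = 2)//; apply; lra.
have p0 : 0 <= (prime_count n.*2)%:R :> R by [].
move: (prime_count n)%:R (prime_count n.*2)%:R c0 p0 h => a b a0 b0 h.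
have hb : b * ln n%:R <= 8 * n%:R by nra.
have : b * ln n%:R * n%:R <= 8 * n%:R * n%:R by rewrite ler_pM2r.
have : 0 <= a * ln n%:R * n%:R by rewrite !mulr_ge0// ltW.
nra.
Qed.

(** The bound for the dyadic block starting at [2 n] is at most half of that at [n], so the blocks
    sum geometrically to twice the first bound. *)
Lemma sum_prime_sq_pow n K : (1 < n)%N ->
  \sum_(n.+1 <= p < (2 ^ K * n).+1 | prime p) (p%:R ^+ 2)^-1 <=
  16 / (n%:R * ln n%:R) :> R.
Proof.
elim: K n => [|K IH] n n1.
  rewrite mul1n big_geq// divr_ge0// mulr_ge0 ?ln_ge0//.
  by rewrite ler1n; lia.
have n1' : 1 < n%:R :> R by rewrite ltr1n.
have n0 : 0 < n%:R :> R by lra.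
have ln0 : 0 < ln n%:R :> R by rewrite ln_gt0.
rewrite (big_cat_nat _ (n := n.*2.+1))//=; [|by lia|]; last first.
  by rewrite ltnS expnS -mulnA mul2n leq_double leq_pmull// expn_gt0.
have -> : (2 ^ K.+1 * n = 2 ^ K * n.*2)%N by rewrite expnSr -mulnA mul2n.
apply: le_trans (lerD (sum_prime_sq_double n1) (IH n.*2 ltac:(lia))) _.
have -> : n.*2%:R = 2 * n%:R :> R by rewrite -mul2n natrM.
have -> : 16 / (n%:R * ln n%:R) = 8 / (n%:R * ln n%:R) + 8 / (n%:R * ln n%:R) :> R.
  by rewrite -mulrDl; congr (_ / _); ring.
rewrite lerD2l (_ : 16 / (2 * n%:R * _) = 8 / (n%:R * ln (2 * n%:R)));
  last first.
  by field; rewrite !gt_eqF// ln_gt0; lra.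
rewrite ler_pM2l// lef_pV2 ?posrE ?mulr_gt0// ?ln_gt0//; last by lra.
by rewrite ler_pM2l// ler_ln ?posrE//; lra.
Qed.

(** Rounding [x] down to an integer [t >= 2] costs a bounded factor: [x < t + 1 <= 3 t / 2] and
    [x < t^2], so [x ln x <= 3 t ln t], and 64 exceeds [3 * (1 + 16)]. *)
Lemma prime_sq_sum_le x M : 2 <= x ->
  \sum_(0 <= p < M | prime p && (x <= p%:R)) (p%:R ^+ 2)^-1 <= 64 / (x * ln x).
Proof.
move=> x2; have x0 : 0 < x by lra.
have lx0 : 0 < ln x by rewrite ln_gt0; lra.
have /andP[tx xt] := truncn_itv (ltW x0).
have t1 : (1 < Num.truncn x)%N by rewrite truncn_ge_nat// ltW.
move: (Num.truncn x) tx xt t1 => t tx xt t1.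
have t2 : 2 <= t%:R :> R by rewrite ler_nat.
have lt0 : 0 < ln t%:R :> R by rewrite ln_gt0; lra.
have lxt : ln x <= 2 * ln t%:R.
  rewrite mulr_natl -lnXn; last by lra.
  rewrite ler_ln ?posrE ?exprn_gt0//; last by lra.
  by rewrite -natr1 in xt; rewrite expr2; nra.
have split_t : \sum_(0 <= p < M | prime p && (x <= p%:R)) (p%:R ^+ 2)^-1 <=
   \sum_(t <= p < (2 ^ M * t).+1 | prime p) (p%:R ^+ 2)^-1 :> R.
  apply: (@le_trans _ _
      (\sum_(0 <= p < (2 ^ M * t).+1 | prime p && (x <= p%:R)) (p%:R ^+ 2)^-1)).
    rewrite [leRHS](big_cat_nat _ (n := M))//=; last first.
      by have := ltn_expl M (isT : 1 < 2)%N; nia.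
    by rewrite lerDl; apply: sumr_ge0 => *; rewrite invr_ge0 exprn_ge0.
  rewrite (big_cat_nat _ (n := t))//=; last by have := expn_gt0 2 M; nia.
  rewrite big1_seq ?add0r; last first.
    move=> p; rewrite mem_index_iota => /andP[/andP[_ xp] /andP[_ pt]].
    by exfalso; move: pt; rewrite ltnNge -(ler_nat R); lra.
  rewrite big_mkcond [leRHS]big_mkcond; apply: ler_sum => p _.
  by case: (prime p) => //=; case: ifP => // _; rewrite invr_ge0 exprn_ge0.
apply: le_trans split_t _; rewrite big_mkcond big_ltn//=; last first.
  by have := expn_gt0 2 M; nia.
rewrite -big_mkcond/=.
(* The number [t] itself lies outside the range of [sum_prime_sq_pow] and is estimated
   separately. *)
have ht : (if prime t then (t%:R ^+ 2)^-1 else 0) <= 1 / (t%:R * ln t%:R) :> R.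
  apply: (@le_trans _ _ (t%:R ^+ 2)^-1).
    by case: ifP => // _; rewrite invr_ge0 exprn_ge0.
  rewrite mul1r lef_pV2 ?posrE ?exprn_gt0 ?mulr_gt0//; try lra.
  by rewrite expr2 ler_pM2l; [apply/ltW/ln_sublinear|]; lra.
apply: le_trans (lerD ht (sum_prime_sq_pow M t1)) _.
rewrite -mulrDl ler_pdivrMr ?mulr_gt0//; last by lra.
rewrite mulrAC ler_pdivlMr ?mulr_gt0//.
have : x * ln x <= (2 * t%:R) * (2 * ln t%:R).
  by rewrite -natr1 in xt; apply: ler_pM; lra.
nra.
Qed.

(* With [n = 64 N] the lower bound for [pi(128 N)] beats the upper bound for
   [pi(N)] by a factor two. *)
Lemma prime_count_gap N : (1 < N)%N ->
  N%:R <= ((prime_count (128 * N))%:R - (prime_count N)%:R) * ln N%:R :> R.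
Proof.
move=> N1; have N2 : 2 <= N%:R :> R by rewrite ler_nat.
have := @prime_count_lb (64 * N)%N ltac:(lia).
have -> : ((64 * N).*2 = 128 * N)%N by lia.
have := @prime_count_ub N ltac:(lia).
have l2 := ln2_ge_half; have lN : ln 2 <=
  ln N%:R :> R by rewrite ler_ln ?posrE//; lra.
rewrite !natrM lnM ?posrE//; try lra.
have -> : ln 128 = 7 * ln 2 :> R.
  by rewrite mulr_natl -lnXn//; congr ln; rewrite -natrX.
have a0 : 0 <= (prime_count N)%:R :> R by [].
have b0 : 0 <= (prime_count (128 * N))%:R :> R by [].
move: (prime_count N)%:R (prime_count (128 * N))%:R a0 b0 => a b a0 b0 ha hb.
have : b * (7 * ln 2 + ln N%:R) <= b * (8 * ln N%:R) by apply: ler_wpM2l; lra.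
nra.
Qed.

(** With [n = floor x + 1] at least [n / ln n] primes lie in [(n, 128 n]], each contributing at
    least [1 / (128 n)^2]. As [n <= 2 x] and [ln n <= 2 ln x], the constant is
    [128^2 * 4 = 256^2]. *)
Lemma prime_sq_sum_ge x : 2 <= x ->
  exists M, (256 ^+ 2 * (x * ln x))^-1 <=
    \sum_(0 <= p < M | prime p && (x <= p%:R)) (p%:R ^+ 2)^-1.
Proof.
move=> x2; have x0 : 0 < x by lra.
have lx0 : 0 < ln x by rewrite ln_gt0; lra.
have /andP[tx xt] := truncn_itv (ltW x0).
have t1 : (1 < Num.truncn x)%N by rewrite truncn_ge_nat// ltW.
move: (Num.truncn x) tx xt t1 => t tx xt t1.
have [n nE] : exists n, n = t.+1 by exists t.+1.
exists (128 * n).+1.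
have n1 : (1 < n)%N by rewrite nE; lia.
have n2 : n%:R <= 2 * x by rewrite nE -natr1; lra.
have n0 : 0 < n%:R :> R by rewrite ltr0n; lia.
have ln0 : 0 < ln n%:R :> R by rewrite ln_gt0// ltr1n.
have lnx : ln n%:R <= 2 * ln x.
  rewrite mulr_natl -lnXn// ler_ln ?posrE ?exprn_gt0//.
  by rewrite expr2; nra.
rewrite (big_cat_nat _ (n := n.+1))//=; last by lia.
rewrite -[leLHS]add0r lerD//.
  by apply: sumr_ge0 => *; rewrite invr_ge0 exprn_ge0.
apply: (@le_trans _ _ (\sum_(n.+1 <= p < (128 * n).+1 | prime p)
   ((128 * n)%:R ^+ 2)^-1)); last first.
  rewrite big_seq_cond [leRHS]big_seq_cond big_mkcond [leRHS]big_mkcond.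
  apply: ler_sum => p _; rewrite mem_index_iota.
  case: (boolP (n < p < _)%N) => //= pr; case: (prime p) => //=.
  have -> : x <= p%:R.
    by apply: le_trans (ltW xt) _; rewrite ler_nat; move: pr; rewrite nE; lia.
  by rewrite lef_pV2 ?posrE ?exprn_gt0 ?ltr0n ?lerXn2r ?nnegrE ?ler0n ?ler_nat//; lia.
rewrite sum_prime_const; last by lia.
have := prime_count_gap n1; rewrite natrM.
move: (_ - _) => c hc.
rewrite ler_pdivlMr ?exprn_gt0 ?mulr_gt0// ler_pdivrMl ?mulr_gt0//.
have nc : n%:R <= c * (2 * ln x).
  apply: (le_trans hc); apply: ler_wpM2l => //.
  have : 0 <= c * ln n%:R by exact: le_trans (ltW n0) hc.
  by rewrite pmulr_lge0.
have : n%:R * n%:R <= 2 * x * (c * (2 * ln x)) by apply: ler_pM; lra.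
rewrite !expr2; lra.
Qed.
End prime_sums.

(** * Cylinders of the Gauss map *)

Section cylinders.
Variable R : realType.
Implicit Types (x y t : R) (w : seq nat) (b n : nat).

Local Notation G := (@gauss_map R).

Definition digits n x : seq nat := mkseq (fun k => partial_quotient k.+1 x) n.

Lemma digitsS n x :
  digits n.+1 x = rcons (digits n x) (Num.truncn (iter n G x)^-1).
Proof. exact: mkseqS. Qed.

Lemma size_digits n x : size (digits n x) = n.
Proof. exact: size_mkseq. Qed.

Lemma gauss_map_itv x : 0 <= gauss_map x < 1.
Proof.
rewrite /gauss_map; case: ifPn => _; first by rewrite lexx ltr01.
by rewrite subr_ge0 ltrBlDl floor_le -intrD1 floorD1_gt.
Qed.

Lemma iter_gauss_itv n x : 0 <= x < 1 -> 0 <= iter n G x < 1.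
Proof. by case: n => // n _; exact: gauss_map_itv. Qed.

Lemma gauss_mapE x : 0 < x -> gauss_map x = x^-1 - (Num.truncn x^-1)%:R.
Proof.
move=> x0; rewrite /gauss_map gt_eqF// truncn_floor invr_ge0 ltW//.
by rewrite natr_absz ger0_norm// floor_ge0 invr_ge0 ltW.
Qed.

Lemma truncn_inv_gt0 x : 0 < x < 1 -> (0 < Num.truncn x^-1)%N.
Proof. by move=> /andP[x0 x1]; rewrite truncn_gt0 invf_ge1// ltW. Qed.

Lemma truncn_invD b t : (0 < b)%N -> 0 <= t < 1 ->
  Num.truncn ((b%:R + t)^-1)^-1 = b.
Proof.
move=> b0 /andP[t0 t1]; rewrite invrK; apply: truncn_def.
by rewrite -natr1 lerDl t0 ltrD2l.
Qed.

(* [convergent (0, 1) w] and [convergent (1, 0) w] are the pairs (p_n, p_(n-1))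
   and (q_n, q_(n-1)) of the word [w] of length [n]. *)
Definition convergent (s : R * R) w : R * R :=
  foldl (fun s b => (b%:R * s.1 + s.2, s.1)) s w.

Lemma convergent_rcons s w b : convergent s (rcons w b) =
  (b%:R * (convergent s w).1 + (convergent s w).2, (convergent s w).1).
Proof. exact: foldl_rcons. Qed.

Local Notation P w := (convergent (0, 1) w).
Local Notation Q w := (convergent (1, 0) w).

(* A digit 0 marks a terminated expansion. *)
Definition positive_word w := all (leq 1) w.

Lemma positive_rcons w b :
  positive_word (rcons w b) = (0 < b)%N && positive_word w.
Proof. exact: all_rcons. Qed.

Lemma convergent_den w : positive_word w ->
  [/\ 1 <= (Q w).1, 0 <= (Q w).2 & (Q w).2 <= (Q w).1].
Proof.
elim/last_ind: w => [_|w b IH]; first by split; rewrite //= ?ler01.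
rewrite positive_rcons convergent_rcons/= => /andP[b0 /IH[q1 q2 q12]].
have b1 : 1 <= b%:R :> R by rewrite ler1n.
by split; nra.
Qed.

(** Each digit flips the sign of the classical determinant; the absolute value avoids tracking the
    parity of the length. *)
Lemma convergent_det w :
  `|(P w).1 * (Q w).2 - (P w).2 * (Q w).1| = 1.
Proof.
elim/last_ind: w => [|w b IH] /=.
  by rewrite mul0r mul1r sub0r normrN1.
rewrite !convergent_rcons/= -[RHS]IH -normrN; congr `|_|; ring.
Qed.

(* The inverse branch of the [n]-th iterate of the Gauss map on the cylinder of
   [w]. *)
Definition branch w t : R :=
  ((P w).1 + (P w).2 * t) / ((Q w).1 + (Q w).2 * t).

Lemma branch_den w t : positive_word w -> 0 <= t ->
  0 < (Q w).1 + (Q w).2 * t.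
Proof. by move=> /convergent_den[q1 q2 _] t0; nra. Qed.

Lemma branch_rcons w b t : positive_word w -> (0 < b)%N -> 0 <= t ->
  branch (rcons w b) t = branch w (b%:R + t)^-1.
Proof.
move=> pw b0 t0; have bt : 0 < b%:R + t by rewrite ltr_pwDl// ltr0n.
have d0 : 0 < (Q w).1 + (Q w).2 * (b%:R + t)^-1.
  by apply: branch_den; rewrite // invr_ge0 ltW.
have d1 : 0 < (Q (rcons w b)).1 + (Q (rcons w b)).2 * t.
  by apply: branch_den => //; rewrite positive_rcons b0.
rewrite /branch; rewrite !convergent_rcons/= in d1 *.
field; rewrite !gt_eqF//=.
rewrite (_ : _ + _ = (b%:R * (Q w).1 + (Q w).2) + (Q w).1 * t)//; ring.
Qed.

Lemma branch_digits n x : 0 <= x < 1 -> positive_word (digits n x) ->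
  x = branch (digits n x) (iter n G x).
Proof.
move=> x01; elim: n => [_|n IH];
  first by rewrite /branch /= !(mul0r, mul1r, add0r, addr0, divr1).
rewrite digitsS positive_rcons => /andP[a0 /[dup] pw /IH {1}->].
have /andP[y0 y1] := iter_gauss_itv n x01; move: a0; rewrite iterS.
move: (iter n G x) y0 y1 => y y0 y1 a0.
have y0' : 0 < y.
  rewrite lt_neqAle y0 andbT eq_sym; apply/eqP => yE.
  by rewrite yE invr0 truncn0 in a0.
have /andP[g0 _] := gauss_map_itv y.
rewrite branch_rcons//; congr branch.
by rewrite gauss_mapE// addrC subrK invrK.
Qed.

(** The interval for [t] has to be open: the empty word at [t = 1] and the word of the single digit
    1 at [t = 0] both give the point 1, outside [0, 1). *)
Lemma digits_branch w t : positive_word w -> 0 < t < 1 ->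
  [/\ 0 < branch w t < 1, digits (size w) (branch w t) = w &
      iter (size w) G (branch w t) = t].
Proof.
elim/last_ind: w t => [|w b IH] t pw t01.
  by rewrite /branch /= !(mul0r, mul1r, add0r, addr0, divr1).
move: pw; rewrite positive_rcons => /andP[b0 pw].
have /andP[t0 t1] := t01.
have b1 : 1 <= b%:R :> R by rewrite ler1n.
have bt01 : 0 < (b%:R + t)^-1 < 1.
  by rewrite invr_gt0 invf_lt1; lra.
rewrite branch_rcons// ?ltW//; have [xi xd xG] := IH _ pw bt01.
rewrite size_rcons digitsS iterS xd xG; split => //.
  by rewrite truncn_invD// ltW.
rewrite gauss_mapE; last by case/andP: bt01.
by rewrite truncn_invD ?(ltW t0)// invrK addrC addKr.
Qed.

(* The weight making [branch w t] a convex combination of the endpoints. *)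
Lemma branch_convex w t : positive_word w -> 0 <= t <= 1 ->
  exists2 l, 0 <= l <= 1 & branch w t = (1 - l) * branch w 0 + l * branch w 1.
Proof.
move=> pw /andP[t0 t1]; have [q1 q2 q12] := convergent_den pw.
have d := branch_den pw t0.
exists (t * ((Q w).1 + (Q w).2) / ((Q w).1 + (Q w).2 * t)).
  rewrite divr_ge0 ?mulr_ge0 ?ler_pdivrMr//; try lra.
  nra.
by rewrite /branch !mulr0 !addr0 !mulr1; field; rewrite !gt_eqF//; lra.
Qed.

(** The witness solves [l = t (q + q') / (q + q' t)], the weight of [branch_convex], for [t]. *)
Lemma convex_branch w l : positive_word w -> 0 < l < 1 ->
  exists2 t, 0 < t < 1 & (1 - l) * branch w 0 + l * branch w 1 = branch w t.
Proof.
move=> pw /andP[l0 l1]; have [q1 q2 q12] := convergent_den pw.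
have d : 0 < l * (Q w).1 + (1 - l) * ((Q w).1 + (Q w).2) by nra.
have t0 : 0 < l * (Q w).1 / (l * (Q w).1 + (1 - l) * ((Q w).1 + (Q w).2)).
  by rewrite divr_gt0// mulr_gt0//; lra.
exists (l * (Q w).1 / (l * (Q w).1 + (1 - l) * ((Q w).1 + (Q w).2))).
  rewrite t0 ltr_pdivrMr// mul1r; nra.
have := branch_den pw (ltW t0).
rewrite /branch !mulr0 !addr0 !mulr1; move: d.
move: (P w).1 (P w).2 => p1 p2 d dt; field; rewrite !gt_eqF//; try lra; try nra.
Qed.

Definition cylinder w : set R :=
  [set x | 0 <= x < 1 /\ digits (size w) x = w].

Definition cylinder_length w : R := ((Q w).1 * ((Q w).1 + (Q w).2))^-1.

Lemma cylinder_length_gt0 w : positive_word w -> 0 < cylinder_length w.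
Proof. by move=> /convergent_den[q1 q2 _]; rewrite invr_gt0; nra. Qed.

Lemma branch_length w : positive_word w ->
  `|branch w 1 - branch w 0| = cylinder_length w.
Proof.
move=> pw; have [q1 q2 q12] := convergent_den pw.
rewrite /branch /cylinder_length !mulr0 !addr0 !mulr1.
have -> : ((P w).1 + (P w).2) / ((Q w).1 + (Q w).2) - (P w).1 / (Q w).1 =
  - ((P w).1 * (Q w).2 - (P w).2 * (Q w).1) * ((Q w).1 * ((Q w).1 + (Q w).2))^-1.
  by field; rewrite !gt_eqF//; lra.
rewrite normrM normrN convergent_det mul1r gtr0_norm// invr_gt0 mulr_gt0//; lra.
Qed.

(** The order of the endpoints, and which of them belong to the cylinder, vary with the word;
    neither affects the measure. *)
Lemma cylinder_sandwich w : positive_word w ->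
  exists a c : R, [/\ c - a = cylinder_length w, `]a, c[ `<=` cylinder w &
                  cylinder w `<=` `[a, c]].
Proof.
move=> pw; exists (Num.min (branch w 0) (branch w 1)), (Num.max (branch w 0) (branch w 1)).
have bl := branch_length pw; have l0 := cylinder_length_gt0 pw.
split.
- rewrite -bl; case: (leP (branch w 0) (branch w 1)) => h;
  [rewrite ger0_norm// subr_ge0//|].
  by rewrite ltr0_norm ?opprB// subr_lt0.
- move=> x /=; rewrite in_itv/= => xI.
  have nz : branch w 1 - branch w 0 != 0 by rewrite -normr_eq0 bl gt_eqF.
  pose l := (x - branch w 0) / (branch w 1 - branch w 0).
  have l01 : 0 < l < 1.
    rewrite /l; move: xI nz; case: (leP (branch w 0) (branch w 1)) =>
      h /andP[ax xb] nz.
      by rewrite divr_gt0 ?ltr_pdivrMr; lra.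
    rewrite (_ : _ / _ = (branch w 0 - x) / (branch w 0 - branch w 1)).
      by rewrite divr_gt0 ?ltr_pdivrMr; lra.
    by rewrite -mulrNN -invrN !opprB.
  have [t t01 xt] := convex_branch pw l01.
  have xE : x = branch w t by rewrite -xt /l; field.
  have [/andP[x0 x1] xd _] := digits_branch pw t01.
  by rewrite /cylinder/= xE (ltW x0) x1.
- move=> x [x01 xd]; have xp : positive_word (digits (size w) x) by rewrite xd.
  have /andP[t0 t1] := iter_gauss_itv (size w) x01.
  have := branch_digits x01 xp; rewrite xd => ->.
  have [|l l01 ->] := @branch_convex w (iter (size w) G x) pw.
    by rewrite t0 ltW.
  rewrite /= in_itv/=; case: (leP (branch w 0) (branch w 1)) => h; apply/andP;
    split; nra.
Qed.

Definition finite_expansions : set R := range (fun w => branch w 0).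

Lemma countable_finite_expansions : countable finite_expansions.
Proof.
apply: sub_countable (card_image_le _ _) _; exact: countableP.
Qed.

(** The first digit 0 occurs where the remainder vanishes, so [x] is the branch of the preceding
    positive word at 0. *)
Lemma finite_expansionsP n x : 0 <= x < 1 -> ~~ positive_word (digits n x) ->
  finite_expansions x.
Proof.
move=> x01; elim: n => // n IH; have [pw|npw] :=
  boolP (positive_word (digits n x)).
  rewrite digitsS positive_rcons pw andbT -leqNgt leqn0 => /eqP a0.
  exists (digits n x) => //; rewrite [RHS](branch_digits x01 pw); congr branch.
  have /andP[y0 y1] := iter_gauss_itv n x01.
  apply/eqP; rewrite eq_le y0 /= leNgt; apply/negP => y0'.
  by have := @truncn_inv_gt0 (iter n G x); rewrite a0 y0' y1 => /(_ isT).
by move=> _; exact: IH.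
Qed.

Lemma measurable_countable (A : set R) : countable A ->
  measurable (A : set (measurableTypeR R)).
Proof. by apply: countable_measurable => t; exact: measurable_set1. Qed.

Lemma cylinder_null w : ~~ positive_word w ->
  countable (cylinder w).
Proof.
move=> npw; apply: sub_countable countable_finite_expansions.
apply: subset_card_le => x [x01 xd]; apply: (@finite_expansionsP (size w)) =>
  //.
by rewrite xd.
Qed.

Lemma measurable_cylinder w : measurable (cylinder w : set (measurableTypeR R)).
Proof.
have [pw|npw] := boolP (positive_word w); last first.
  by apply: measurable_countable; exact: cylinder_null.
have [a [b [_ oc cc]]] := cylinder_sandwich pw.
have -> : cylinder w = `]a, b[ `|` (cylinder w `&` [set a; b]).
  rewrite eqEsubset; split => [x xc|x [/oc//|[]//]].
  have := cc _ xc; rewrite /= !in_itv/= => /andP[].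
  rewrite !le_eqVlt => /orP[/eqP ax _|ax]; first by right; split => //; left.
  move=> /orP[/eqP xb|xb]; first by right; split => //; right.
  by left; rewrite /= ?in_itv ax.
apply: measurableU; first exact: measurable_itv.
apply: measurable_countable; apply: finite_set_countable.
by apply: sub_finite_set (finite_set2 a b); exact: subIsetr.
Qed.

Lemma measure_cylinder w : positive_word w ->
  lebesgue_measure (cylinder w) = (cylinder_length w)%:E.
Proof.
move=> pw; have [a [b [ba oc cc]]] := cylinder_sandwich pw.
have l0 := cylinder_length_gt0 pw.
have ab : a < b by rewrite -subr_gt0 ba.
apply/eqP; rewrite eq_le; apply/andP; split.
  have -> : (cylinder_length w)%:E = lebesgue_measure `[a, b].
    by rewrite lebesgue_measure_itv/= lte_fin ab -EFinB ba.
  by apply: le_measure => //; rewrite inE;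
    [exact: measurable_cylinder|exact: measurable_itv].
have -> : (cylinder_length w)%:E = lebesgue_measure `]a, b[.
  by rewrite lebesgue_measure_itv/= lte_fin ab -EFinB ba.
by apply: le_measure => //; rewrite inE;
  [exact: measurable_itv|exact: measurable_cylinder].
Qed.

(** For denominators [q' <= q] the ratio of lengths is [q (q + q') / ((b q + q') (b q + q' + q))],
    whose numerator is at most [2 q^2] and whose denominator is at least [b^2 q^2]. *)
Lemma cylinder_length_rcons_le w b : positive_word w -> (0 < b)%N ->
  cylinder_length (rcons w b) <= 2 * (b%:R ^+ 2)^-1 * cylinder_length w.
Proof.
move=> pw b0; have [q1 q2 q12] := convergent_den pw.
have b1 : 1 <= b%:R :> R by rewrite ler1n.
rewrite /cylinder_length convergent_rcons/= -mulrA -invfM.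
move: (Q w).1 (Q w).2 (b%:R) q1 q2 q12 b1 => q q' c q1 q2 q12 c1.
rewrite ler_pdivlMr; last by rewrite mulr_gt0 ?exprn_gt0//; nra.
have cq : 0 < c * q by rewrite mulr_gt0; lra.
rewrite mulrC ler_pdivrMr; last by rewrite mulr_gt0; lra.
have : (c * q) * (c * q) <= (c * q + q') * (c * q + q' + q) by apply: ler_pM;
  lra.
have : c ^+ 2 * (q * (q + q')) <= c ^+ 2 * (q * (2 * q)).
  by rewrite ler_wpM2l ?ler_wpM2l//; nra.
nra.
Qed.

(** In the same ratio, [b q + q' <= b (q + q')] and [b q + q' + q <= 3 b q]. *)
Lemma cylinder_length_rcons_ge w b : positive_word w -> (0 < b)%N ->
  (3 * b%:R ^+ 2)^-1 * cylinder_length w <= cylinder_length (rcons w b).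
Proof.
move=> pw b0; have [q1 q2 q12] := convergent_den pw.
have b1 : 1 <= b%:R :> R by rewrite ler1n.
rewrite /cylinder_length convergent_rcons/= -invfM.
move: (Q w).1 (Q w).2 (b%:R) q1 q2 q12 b1 => q q' c q1 q2 q12 c1.
have cq : 0 < c * q by rewrite mulr_gt0; lra.
rewrite lef_pV2 ?posrE ?mulr_gt0 ?exprn_gt0//; try lra.
rewrite (_ : 3 * c ^+ 2 * _ = (c * (q + q')) * (3 * (c * q))); last by ring.
by apply: ler_pM; nra.
Qed.

End cylinders.

(** * Events determined by finitely many digits *)

Section digit_events.
Variable R : realType.
Implicit Types (x y : R) (w : seq nat) (b k m n : nat) (A B : set R) (S : pred nat).

Local Notation mu := (@lebesgue_measure R).
Local Notation I01 := [set x : R | 0 <= x < 1].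

(** The sigma-algebra of the first [n] digits, encoded by invariance: Boolean operations are
    immediate, and measurability follows because there are only countably many words. *)
Definition determined n A := A `<=` I01 /\
  forall x y, 0 <= x < 1 -> 0 <= y < 1 -> digits n x = digits n y -> A x -> A y.

Lemma digits_take m n x : (m <= n)%N -> digits m x = take m (digits n x).
Proof.
by move=> mn; rewrite /digits /mkseq -map_take take_iota (minn_idPl mn).
Qed.

Lemma determinedW m n A : (m <= n)%N -> determined m A -> determined n A.
Proof.
move=> mn [A01 dA]; split => // x y x01 y01 xy; apply: dA => //.
by rewrite !(digits_take _ mn) xy.
Qed.

Lemma determined01 n : determined n I01. Proof. by split. Qed.

Lemma determinedI n A B : determined n A -> determined n B ->
  determined n (A `&` B).
Proof.
move=> [A01 dA] [_ dB]; split => [x [/A01]//|x y x01 y01 xy [Ax Bx]].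
by split; [exact: dA Ax|exact: dB Bx].
Qed.

Lemma determinedD n A B : determined n A -> determined n B ->
  determined n (A `\` B).
Proof.
move=> [A01 dA] [_ dB]; split => [x [/A01]//|x y x01 y01 xy [Ax nBx]].
by split; [exact: dA Ax|move=> /dB Bx; apply: nBx; exact: Bx].
Qed.

Definition hit k S : set R := [set x | 0 <= x < 1 /\ S (partial_quotient k x)].

Lemma nth_digits n k x : (k < n)%N ->
  nth 0%N (digits n x) k = partial_quotient k.+1 x.
Proof. exact: nth_mkseq. Qed.

Lemma determined_quotient n k x y : (0 < k <= n)%N -> digits n x = digits n y ->
  partial_quotient k x = partial_quotient k y.
Proof. by case: k => // k kn xy; rewrite -!(@nth_digits n) ?xy. Qed.

Lemma determined_hit n k S : (0 < k <= n)%N -> determined n (hit k S).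
Proof.
move=> kn; split => [x []//|x y x01 y01 xy [_ xS]]; split => //.
by rewrite -(determined_quotient kn xy).
Qed.

Lemma cylinder_digits n x y :
  cylinder (digits n x) y <-> 0 <= y < 1 /\ digits n y = digits n x.
Proof. by rewrite /cylinder /= size_digits. Qed.

Lemma determined_cylinder n A w : determined n A -> size w = n ->
  A `&` cylinder w = cylinder w \/ A `&` cylinder w = set0.
Proof.
move=> [A01 dA] sw; have [[x [Ax wx]]|nA] :=
  pselect (exists x, A x /\ cylinder w x).
  left; rewrite eqEsubset; split => [y []//|y wy]; split => //.
  case: wx wy => x01 xw [y01 yw]; apply: dA x01 y01 _ Ax.
  by rewrite -sw xw yw.
by right; rewrite -subset0 => y [Ay wy]; apply: nA; exists y.
Qed.

Lemma determined_measurable n A : determined n A ->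
  measurable (A : set (measurableTypeR R)).
Proof.
move=> dA; pose F w := if size w == n then A `&` cylinder w else set0.
have -> : A = \bigcup_w F w.
  rewrite eqEsubset; split => [x Ax|x [w _]]; last first.
    by rewrite /F; case: ifP => // _ [].
  exists (digits n x) => //; rewrite /F size_digits eqxx; split => //.
  by apply/cylinder_digits; split=> //; case: dA => + _; exact.
apply: countable_bigcupT_measurable; first exact: countableP.
move=> w; rewrite /F; case: eqP => [sw|_]; last exact: measurable0.
have [->|->] := determined_cylinder dA sw; last exact: measurable0.
exact: measurable_cylinder.
Qed.

Lemma measure01 : mu I01 = 1%E.
Proof.
have -> : I01 = `[0, 1[%classic :> set R.
  by apply/seteqP; split => x /=; rewrite in_itv.
by rewrite lebesgue_measure_itv/= lte_fin ltr01 sube0.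
Qed.

Definition prob A : R := fine (mu A).

Lemma probE n A : determined n A -> mu A = (prob A)%:E.
Proof.
move=> dA; rewrite fineK// ge0_fin_numE//.
apply: (@le_lt_trans _ _ (mu I01)); last by rewrite measure01 ltry.
apply: le_measure; rewrite ?inE; last by case: dA.
- exact: determined_measurable dA.
- exact: determined_measurable (determined01 0).
Qed.

Lemma prob_ge0 A : 0 <= prob A. Proof. exact: fine_ge0. Qed.

Lemma le_prob n A B : determined n A -> determined n B -> A `<=` B ->
  prob A <= prob B.
Proof.
move=> dA dB AB; rewrite -lee_fin -(probE dA) -(probE dB).
by apply: le_measure; rewrite ?inE; [exact: determined_measurable dA|
  exact: determined_measurable dB|].
Qed.

Lemma probDI n A B : determined n A -> determined n B ->
  prob A = prob (A `\` B) + prob (A `&` B).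
Proof.
move=> dA dB; apply: EFin_inj; rewrite EFinD.
rewrite -(probE dA) -(probE (determinedD dA dB)) -(probE (determinedI dA dB)).
by apply: measureDI; [exact: determined_measurable dA|exact: determined_measurable dB].
Qed.

Lemma prob01 : prob I01 = 1. Proof. by rewrite /prob measure01. Qed.

(** Disintegration over the past: an inequality valid on every cylinder of rank [n] is summed over
    all of them. *)
Lemma compare_cylinders n A B (c : R) : determined n.+1 A ->
  determined n.+1 B ->
  0 <= c ->
  (forall w, size w = n ->
     (mu (A `&` cylinder w) <= c%:E * mu (B `&` cylinder w))%E) ->
  prob A <= c * prob B.
Proof.
move=> dA dB c0 h; rewrite -lee_fin EFinM -(probE dA) -(probE dB).
(* Coding words by integers turns the partition into cylinders into a sequence, as countable
   additivity requires; codes that no point attains give empty pieces. *)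
pose D i : set R := [set x : R | 0 <= x < 1 /\ pickle (digits n x) = i].
have dD i : determined n.+1 (D i).
  apply: (@determinedW n) => //; split => [x []//|x y x01 y01 xy [_ xi]].
  by split => //; rewrite -xy.
have decomp C : determined n.+1 C ->
    mu C = (\sum_(0 <= i <oo | i \in setT) mu (C `&` D i))%E.
  move=> dC; rewrite -measure_bigcup.
  - congr mu; rewrite -setI_bigcupr eqEsubset; split => [x Cx|x []//].
    split => //; exists (pickle (digits n x)) => //; split => //.
    by case: dC => + _; exact.
  - move=> i _; exact: determined_measurable (determinedI dC (dD i)).
  - by move=> i j _ _ [x [[_ [_ <-]] [_ [_ <-]]]].
rewrite (decomp A dA) (decomp B dB) -nneseriesZl//; apply: lee_nneseries =>
  // i _.
have [[x Dx]|nD] := pselect (exists x, D i x).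
  have -> : D i = cylinder (digits n x).
    case: Dx => x01 <-; rewrite eqEsubset; split => y.
      by move=> [y01 /(pcan_inj pickleK) yx]; apply/cylinder_digits.
    by move=> /cylinder_digits[y01 yx]; split => //; rewrite yx.
  by apply: h; rewrite size_digits.
have -> : D i = set0 by rewrite -subset0 => y Dy; apply: nD; exists y.
by rewrite !setI0 measure0 mule0.
Qed.

Lemma cylinder_rcons w b x :
  cylinder (rcons w b) x <-> cylinder w x /\ partial_quotient (size w).+1 x = b.
Proof.
rewrite /cylinder /= size_rcons digitsS; split.
  by move=> [x01 /rcons_inj[]].
by move=> [[x01 ->] <-].
Qed.

Lemma measure_cylinder_hit w S :
  mu (cylinder w `&` hit (size w).+1 S) =
  (\sum_(0 <= b <oo | S b) mu (cylinder (rcons w b)))%E.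
Proof.
have -> : cylinder w `&` hit (size w).+1 S =
    \bigcup_(b in [set b | S b]) cylinder (rcons w b).
  rewrite eqEsubset; split => x.
    move=> [wx [x01 Sx]]; exists (partial_quotient (size w).+1 x) => //.
    by apply/cylinder_rcons.
  move=> [b /= Sb /cylinder_rcons[wx xb]]; split => //; split;
    first by case: wx.
  by rewrite xb.
rewrite measure_bigcup.
- by apply: eq_eseriesl => b; apply/idP/idP => [/set_mem|Sb];
  last apply/mem_set.
- move=> b _; exact: measurable_cylinder.
- by move=> b b' _ _ [x [/cylinder_rcons[_ <-] /cylinder_rcons[_ <-]]].
Qed.

Lemma cylinder_null_measure w : ~~ positive_word w -> mu (cylinder w) = 0%E.
Proof. by move=> /cylinder_null /countable_lebesgue_measure0. Qed.

(** Excluding 0 from [S] keeps the extended words positive, so that their lengths can be compared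
    with that of [w]. If [w] itself contains 0, both sides vanish. *)
Lemma hit_cylinder_le w S (g : R) : ~~ S 0%N ->
  (forall M, \sum_(0 <= b < M | S b) (b%:R ^+ 2)^-1 <= g) ->
  (mu (cylinder w `&` hit (size w).+1 S) <= (2 * g)%:E * mu (cylinder w))%E.
Proof.
move=> S0 hg; have [pw|npw] := boolP (positive_word w); last first.
  rewrite cylinder_null_measure// mule0 -(cylinder_null_measure npw).
  apply: le_measure; rewrite ?inE; last exact: subIsetl.
    apply: measurableI; first exact: measurable_cylinder.
    by apply: (@determined_measurable (size w).+1); apply: determined_hit;
      rewrite leqnn.
  exact: measurable_cylinder.
rewrite measure_cylinder_hit measure_cylinder// -EFinM.
apply: lime_le; first exact: is_cvg_nneseries.
apply: nearW => M; rewrite (eq_bigr (fun b =>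
  (cylinder_length R (rcons w b))%:E)); last first.
  move=> b Sb; rewrite measure_cylinder// positive_rcons pw andbT.
  by case: b Sb S0 => // ->.
rewrite sumEFin lee_fin.
apply: (@le_trans _ _ (\sum_(0 <= b < M | S b)
   (2 * (b%:R ^+ 2)^-1 * cylinder_length R w))).
  apply: ler_sum => b Sb; apply: cylinder_length_rcons_le => //.
  by case: b Sb S0 => // ->.
rewrite -mulr_suml -mulr_sumr ler_wpM2r ?ler_wpM2l//.
exact/ltW/cylinder_length_gt0.
Qed.

Lemma hit_cylinder_ge w S (g : R) M : ~~ S 0%N ->
  g <= \sum_(0 <= b < M | S b) (b%:R ^+ 2)^-1 ->
  ((g / 3)%:E * mu (cylinder w) <= mu (cylinder w `&` hit (size w).+1 S))%E.
Proof.
move=> S0 hg; have [pw|npw] := boolP (positive_word w); last first.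
  by rewrite cylinder_null_measure// mule0.
rewrite measure_cylinder_hit measure_cylinder// -EFinM.
apply: le_trans (nneseries_lim_ge M _) => //.
rewrite (eq_bigr (fun b => (cylinder_length R (rcons w b))%:E)); last first.
  move=> b Sb; rewrite measure_cylinder// positive_rcons pw andbT.
  by case: b Sb S0 => // ->.
rewrite sumEFin lee_fin.
apply: (@le_trans _ _ (\sum_(0 <= b < M | S b)
   ((b%:R ^+ 2)^-1 / 3 * cylinder_length R w))); last first.
  apply: ler_sum => b Sb; rewrite -invfM [_ ^+ 2 * 3]mulrC;
    apply: cylinder_length_rcons_ge => //.
  by case: b Sb S0 => // ->.
rewrite -!mulr_suml ler_wpM2r ?ler_wpM2r//.
exact/ltW/cylinder_length_gt0.
Qed.

Lemma prob_hit_le n A S (g : R) : determined n A -> ~~ S 0%N ->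
  (forall M, \sum_(0 <= b < M | S b) (b%:R ^+ 2)^-1 <= g) ->
  prob (A `&` hit n.+1 S) <= 2 * g * prob A.
Proof.
move=> dA S0 hg; have dA' := determinedW (leqnSn n) dA.
apply: compare_cylinders; [|exact: dA'| |].
- by apply: determinedI => //; apply: determined_hit; rewrite leqnn.
- by have := hg 0%N; rewrite big_geq// => g0; rewrite mulr_ge0.
move=> w sw; rewrite setIAC.
have [->|->] := determined_cylinder dA sw; last by rewrite set0I measure0 mule0.
by rewrite -sw hit_cylinder_le.
Qed.

Lemma prob_hit_ge n A S (g : R) M : determined n A -> ~~ S 0%N -> 0 < g ->
  g <= \sum_(0 <= b < M | S b) (b%:R ^+ 2)^-1 ->
  g / 3 * prob A <= prob (A `&` hit n.+1 S).
Proof.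
move=> dA S0 g0 hg; have dA' := determinedW (leqnSn n) dA.
(* The constant moves to the other side because [compare_cylinders] only bounds one probability
   above by a multiple of another. *)
rewrite -ler_pdivlMl ?divr_gt0//; apply: compare_cylinders; [exact: dA'| | |].
- by apply: determinedI => //; apply: determined_hit; rewrite leqnn.
- by rewrite invr_ge0 divr_ge0// ltW.
move=> w sw; rewrite setIAC.
have [->|->] := determined_cylinder dA sw; last by rewrite set0I measure0 mule0.
rewrite lee_pdivlMl ?divr_gt0// -sw; exact: hit_cylinder_ge hg.
Qed.

End digit_events.

(** * Hits in blocks of digits *)

Section blocks.
Variable R : realType.
Implicit Types (x y : R) (w : seq nat) (b k m n : nat) (A B : set R) (S : pred nat).

Local Notation mu := (@lebesgue_measure R).
Local Notation I01 := [set x : R | 0 <= x < 1].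

Lemma le_probU n A B C : determined n A -> determined n B -> determined n C ->
  C `<=` A `|` B -> prob C <= prob A + prob B.
Proof.
move=> dA dB dC CAB; rewrite (probDI dC dB); apply: lerD.
  apply: le_prob (determinedD dC dB) dA _ => x [Cx nBx].
  by have [] := CAB x Cx.
by apply: le_prob (determinedI dC dB) dB _; exact: subIsetr.
Qed.

Definition some_hit n S : set R :=
  [set x | 0 <= x < 1 /\ exists2 k, (0 < k <= n)%N & S (partial_quotient k x)].

Definition two_hits n S : set R :=
  [set x | 0 <= x < 1 /\ exists k l : nat, [/\ (0 < k <= n)%N, (0 < l <= n)%N,
    k <> l, S (partial_quotient k x) & S (partial_quotient l x)]].

Lemma determined_some_hit n S : determined n (some_hit n S).
Proof.
split=> [x []//|x y x01 y01 xy [_ [k kn Sk]]]; split=> //; exists k => //.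
by rewrite -(determined_quotient kn xy).
Qed.

Lemma determined_two_hits n S : determined n (two_hits n S).
Proof.
split=> [x []//|x y x01 y01 xy [_ [k [l [kn ln kl Sk Sl]]]]]; split=> //.
exists k, l; split=> //.
  by rewrite -(determined_quotient kn xy).
by rewrite -(determined_quotient ln xy).
Qed.

(** A union bound over pairs, arranged by the larger index: a new pair consists of a hit at [n + 1]
    and one among the first [n] digits, and conditioning the former on the latter gives at most
    [d * (n d)]. *)
Lemma prob_two_hits_le S (d : R) n : 0 <= d ->
  (forall m B, determined m B -> prob (B `&` hit m.+1 S) <= d * prob B) ->
  prob (two_hits n S) <= n%:R ^+ 2 * d ^+ 2.
Proof.
move=> d0 hd.
have h1 m : prob (some_hit m S) <= m%:R * d.
  elim: m => [|m IH].
    rewrite mul0r (_ : some_hit 0 S = set0) ?/prob ?measure0//.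
    by rewrite -subset0 => x [_ [k]]; lia.
  have d01 := determined01 R m.
  have := hd m _ d01; rewrite prob01 mulr1 => hm.
  rewrite -natr1 mulrDl mul1r; apply: le_trans (lerD IH hm).
  apply: (@le_probU m.+1).
  - exact: determinedW (leqnSn m) (determined_some_hit m S).
  - apply: determinedI; first exact: determined01.
    by apply: determined_hit; rewrite leqnn.
  - exact: determined_some_hit.
  - move=> x [x01 [k kn Sk]].
    have [km|km] := leqP k m; first by left; split=> //; exists k => //; lia.
    by right; split=> //; split=> //; have -> : m.+1 = k by lia.
elim: n => [|n IH].
  rewrite expr0n mul0r (_ : two_hits 0 S = set0) ?/prob ?measure0//.
  by rewrite -subset0 => x [_ [k [l []]]]; lia.
have h := hd n _ (determined_some_hit n S).
have : prob (two_hits n.+1 S) <=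
    prob (two_hits n S) + prob (some_hit n S `&` hit n.+1 S).
  apply: (@le_probU n.+1).
  - exact: determinedW (leqnSn n) (determined_two_hits n S).
  - apply: determinedI; first exact: determinedW (leqnSn n) (determined_some_hit n S).
    by apply: determined_hit; rewrite leqnn.
  - exact: determined_two_hits.
  - move=> x [x01 [k [l [kn ln kl Sk Sl]]]].
    have [km|km] := leqP k n; have [lm|lm] := leqP l n.
    + by left; split=> //; exists k, l; split=> //; lia.
    + right; split; first by split=> //; exists k => //; lia.
      by split=> //; have -> : n.+1 = l by lia.
    + right; split; first by split=> //; exists l => //; lia.
      by split=> //; have -> : n.+1 = k by lia.
    + by exfalso; lia.
move=> /le_trans; apply; apply: le_trans (lerD IH h) _.
apply: le_trans (lerD (lexx _) (ler_wpM2l d0 (h1 n))) _.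
rewrite -natr1; have : 0 <= n%:R :> R by []; move: (n%:R : R) => N N0.
rewrite -subr_ge0 (_ : _ - _ = N * d ^+ 2 + d ^+ 2); last by ring.
by rewrite addr_ge0 ?mulr_ge0 ?exprn_ge0.
Qed.

Definition miss n M S : set R :=
  [set x | 0 <= x < 1 /\
    forall k, (n < k <= n + M)%N -> ~~ S (partial_quotient k x)].

Lemma determined_miss n M S : determined (n + M) (miss n M S).
Proof.
split=> [x []//|x y x01 y01 xy [_ nS]]; split=> // k kn.
have kn' : (0 < k <= n + M)%N by lia.
by rewrite -(determined_quotient kn' xy); exact: nS.
Qed.

Section lower.
Variables (S : pred nat) (c : R).
Hypothesis c01 : 0 <= c <= 1.
Hypothesis hc : forall m B, determined m B ->
  c * prob B <= prob (B `&` hit m.+1 S).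

(** Each further digit contributes a factor [1 - c], since the event of having missed so far is
    itself determined by the past. *)
Lemma prob_miss_le n M A : determined n A ->
  prob (A `&` miss n M S) <= (1 - c) ^+ M * prob A.
Proof.
move=> dA; have dAM m : determined (n + m) (A `&` miss n m S).
  apply: determinedI (determined_miss n m S).
  exact: determinedW (leq_addr m n) dA.
elim: M => [|M IH].
  rewrite expr0 mul1r; apply: le_prob (dAM 0%N) _ _; last exact: subIsetl.
  by rewrite addn0.
have dh : determined (n + M).+1 (hit (n + M).+1 S : set R).
  by apply: determined_hit; rewrite leqnn.
have dB := determinedW (leqnSn (n + M)) (dAM M).
have := probDI dB dh; have := hc (dAM M).
have : prob (A `&` miss n M.+1 S) <=
  prob ((A `&` miss n M S) `\` hit (n + M).+1 S).
  apply: (@le_prob _ (n + M).+1); first by rewrite -addnS.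
    exact: determinedD.
  move=> x [Ax [x01 nS]]; split; last by move=> [_]; apply/negP/nS; lia.
  by split=> //; split=> // k kn; apply: nS; lia.
rewrite exprSr mulrAC; case/andP: c01 => c0 c1.
have : (1 - c) * prob (A `&` miss n M S) <= (1 - c) * ((1 - c) ^+ M * prob A).
  by rewrite ler_wpM2l// subr_ge0.
lra.
Qed.

(** Taking the hits in two disjoint blocks makes their indices distinct and lets the second be
    conditioned on the first. *)
Definition hit_twice n M : set R :=
  [set x | 0 <= x < 1 /\ (~ miss n M S x /\ ~ miss (n + M) M S x)].

Lemma determined_hit_twice n M : determined (n + M + M) (hit_twice n M).
Proof.
have d1 := determinedW (leq_addr M _) (determined_miss n M S).
have d2 := determined_miss (n + M) M S.
have -> : hit_twice n M = (I01 `\` miss n M S) `\` miss (n + M) M S.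
  by rewrite eqEsubset; split=> x => [[x01 []]|[[x01 ? ?]]].
by apply: determinedD => //; apply: determinedD => //; exact: determined01.
Qed.

(* A first hit fails with probability at most [(1 - c) ^+ M], and so does the
   second one given the first. *)
Lemma prob_hit_twice n M A : determined n A ->
  prob (A `\` hit_twice n M) <= (1 - (1 - (1 - c) ^+ M) ^+ 2) * prob A.
Proof.
move=> dA; have dA1 : determined (n + M) A by apply: determinedW dA; lia.
have dA2 : determined (n + M + M) A by apply: determinedW dA; lia.
have d1 := determined_miss n M S.
have d1' : determined (n + M + M) (miss n M S) by apply: determinedW d1; lia.
have dh := determinedD dA2 (determined_hit_twice n M).
rewrite (probDI dh d1').
have -> : (A `\` hit_twice n M) `\` miss n M S =
          (A `\` miss n M S) `&` miss (n + M) M S.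
  rewrite eqEsubset; split=> x.
    move=> [[Ax nh] n1]; split=> //; apply: contrapT => n2; apply: nh.
    by split=> //; case: dA => + _; exact.
  by move=> [[Ax n1] n2]; split=> //; split=> // -[_ []].
have -> : (A `\` hit_twice n M) `&` miss n M S = A `&` miss n M S.
  rewrite eqEsubset; split=> x; first by move=> [[]].
  by move=> [Ax n1]; split=> //; split=> // -[_ []].
(* Let [p] be the probability of [A], [v] that of missing the first block within [A], and
   [r = (1 - c)^M]. Failure costs at most [v + r (p - v)], and [v <= r p] bounds this by
   [(2 r - r^2) p = (1 - (1 - r)^2) p]. *)
have := prob_miss_le M dA; have := prob_miss_le M (determinedD dA1 d1).
have := probDI dA1 d1; have p0 := prob_ge0 A.
have /andP[c0 c1] := c01.
have r0 : 0 <= (1 - c) ^+ M by rewrite exprn_ge0; lra.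
have r1 : (1 - c) ^+ M <= 1 by rewrite exprn_ile1; lra.
move: (prob A) (prob _) (prob _) (prob _) ((1 - c) ^+ M) p0 r0 r1 =>
  p u v z r p0 r0 r1.
nra.
Qed.

End lower.

(** * A converse of Borel-Cantelli under conditional lower bounds *)

Section converse.
Variables (F : nat -> set R) (N : nat -> nat) (d : nat -> R).
Hypothesis N_nd : forall j, (N j <= N j.+1)%N.
Hypothesis dF : forall j, determined (N j.+1) (F j).
Hypothesis d01 : forall j, 0 <= d j <= 1.
Hypothesis hd : forall j A, determined (N j) A ->
  prob (A `\` F j) <= (1 - d j) * prob A.

Let avoid J K : set R :=
  [set x | 0 <= x < 1 /\ forall j, (J <= j < J + K)%N -> ~ F j x].

Let avoidS J K : avoid J K.+1 = avoid J K `\` F (J + K).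
Proof.
rewrite eqEsubset; split=> x.
  move=> [x01 h]; split; last by apply: h; lia.
  by split=> // j jK; apply: h; lia.
move=> [[x01 h] nF]; split=> // j jK.
have [jl|jl] := ltnP j (J + K)%N; first by apply: h; lia.
by have -> : j = (J + K)%N by lia.
Qed.

Let determined_avoid J K : determined (N (J + K)) (avoid J K).
Proof.
elim: K => [|K IH]; last first.
  rewrite avoidS addnS; apply: determinedD; last exact: dF.
  exact: determinedW (N_nd _) IH.
have -> : avoid J 0 = I01.
  by rewrite eqEsubset; split=> x; [case|move=> x01; split=> //; lia].
exact: determined01.
Qed.

(** The product of the factors [1 - d j] is controlled by [1 / (1 + s)], with [s] the sum of the
    [d j]; the induction step is [(1 - e) (1 + s + e) <= 1 + s]. *)
Let prob_avoid J K :
  prob (avoid J K) * (1 + \sum_(J <= j < J + K) d j) <= 1.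
Proof.
elim: K => [|K IH].
  rewrite addn0 big_geq// addr0 mulr1 -[leRHS](prob01 R).
  have dJ := determined_avoid J 0.
  by apply: le_prob dJ (determined01 _ _) _ => x [].
rewrite addnS big_nat_recr ?leq_addr//= avoidS.
have h := hd (determined_avoid J K).
have /andP[d0 d1] := d01 (J + K).
have s0 : 0 <= \sum_(J <= j < J + K) d j.
  by apply: sumr_ge0 => j _; case/andP: (d01 j).
apply: le_trans IH.
have p0 := prob_ge0 (avoid J K); have p1 := prob_ge0 (avoid J K `\` F (J + K)).
move: (prob _) (prob _) (\sum_(_ <= _ < _) _) (d _) h d0 d1 s0 p0 p1 =>
  p q s e h d0 d1 s0 p0 p1.
apply: (@le_trans _ _ ((1 - e) * p * (1 + (s + e)))).
  by rewrite ler_wpM2r//; lra.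
have : 0 <= p * e * s by rewrite !mulr_ge0.
have : 0 <= p * e * e by rewrite !mulr_ge0.
lra.
Qed.

Hypothesis d_div : forall J (T : R), exists K, T <= \sum_(J <= j < J + K) d j.

(** A point of [0, 1) outside the upper limit avoids every [F j] from some [J] on. For each of the
    countably many [J] this is a null event, by [prob_avoid] and the divergence of the tail from
    [J]. *)
Lemma measure_lim_sup_determined : mu (lim_sup_set F) = 1%E.
Proof.
have mF j : measurable (F j : set (measurableTypeR R)).
  exact: determined_measurable (dF j).
have mL : measurable (lim_sup_set F : set (measurableTypeR R)).
  by apply: bigcapT_measurable => n; apply: bigcup_measurable.
have m01 : measurable (I01 : set (measurableTypeR R)).
  exact: determined_measurable (determined01 R 0).
have mZ J : measurable (\bigcap_K avoid J K : set (measurableTypeR R)).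
  by apply: bigcapT_measurable => K;
    exact: determined_measurable (determined_avoid J K).
have Z0 J : mu (\bigcap_K avoid J K) = 0%E.
  apply/eqP; rewrite eq_le measure_ge0 andbT; apply/lee_addgt0Pr => e e0.
  rewrite add0e; have [K hK] := d_div J e^-1.
  apply: (@le_trans _ _ (mu (avoid J K))).
    apply: le_measure; rewrite ?inE//;
      first exact: determined_measurable (determined_avoid J K).
    exact: bigcap_inf.
  rewrite (probE (determined_avoid J K)) lee_fin.
  have := prob_avoid J K; have := prob_ge0 (avoid J K).
  move: (prob _) (\sum_(_ <= _ < _) _) hK => p s hK p0 ps.
  have ei : 0 < e^-1 by rewrite invr_gt0.
  have : p * e^-1 <= 1 by nra.
  by rewrite ler_pdivrMr// mul1r.
have LI : I01 `&` lim_sup_set F = lim_sup_set F.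
  apply/setIidPr => x /(_ 0%N I)[j _ Fx]; case: (dF j) => + _; exact.
rewrite -LI -measure01 (measureDI mu m01 mL) -[LHS]add0e; congr (_ + _)%E.
apply/esym/eqP; rewrite eq_le measure_ge0 andbT.
have sub : I01 `\` lim_sup_set F `<=` \bigcup_J \bigcap_K avoid J K.
  move=> x [x01 nL]; apply: contrapT => nZ; apply: nL => J _.
  apply: contrapT => nJ; apply: nZ; exists J => // K _; split=> // j jK Fx.
  by apply: nJ; exists j => //=; lia.
have mD := measurableD m01 mL.
apply: (le_trans (measure_sigma_subadditive mu mZ mD sub)).
by rewrite eseries0// => J _ _; exact: Z0.
Qed.

End converse.
End blocks.

(** * Condensation *)

Lemma infinite_natP (A : set nat) :
  infinite_set A <-> forall N, exists2 n, (N <= n)%N & A n.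
Proof.
split=> [iA N|h /finite_seqP[s As]].
  apply: contrapT => nA; apply: iA; apply: sub_finite_set (finite_II N) =>
    n An /=.
  by rewrite ltnNge; apply/negP => Nn; apply: nA; exists n.
have [n ns An] := h (\max_(i <- s) i).+1.
have : n \in s by move: An; rewrite As.
by move=> ins; have := @leq_bigmax_seq _ s predT id n ins isT;
  rewrite leqNgt ns.
Qed.

Section condensation.
Variable R : realType.
Implicit Types (J K j n : nat) (T : R).

(** Either [z j <= 1] eventually, and truncation leaves a tail unchanged, or infinitely many terms
    contribute exactly 1. *)
Lemma sum_min1_unbounded (z : nat -> R) : (forall j, 0 <= z j) ->
  (forall J T, exists K, T <= \sum_(J <= j < J + K) z j) ->
  forall J T, exists K, T <= \sum_(J <= j < J + K) Num.min 1 (z j).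
Proof.
move=> z0 zd J T.
have m0 j : 0 <= Num.min 1 (z j) by rewrite le_min z0 ler01.
have [[J1 hJ1]|nJ] := pselect (exists J1, forall j, (J1 <= j)%N -> z j <= 1).
  have [K hK] := zd (maxn J J1) T; exists (maxn J J1 - J + K)%N.
  rewrite (big_cat_nat _ (n := maxn J J1))//=; [|exact: leq_maxl|lia].
  rewrite addnA subnKC ?leq_maxl//; apply: le_trans hK _.
  rewrite -[leLHS]add0r lerD ?sumr_ge0//.
  rewrite le_eqVlt; apply/orP; left; apply/eqP; apply: eq_big_nat => j jr.
  by rewrite min_r// hJ1//; lia.
have step m : exists K, m%:R <= \sum_(J <= j < J + K) Num.min 1 (z j).
  elim: m => [|m [K hK]]; first by exists 0%N; rewrite addn0 big_geq.
  have [j Kj zj] : exists2 j, (J + K <= j)%N & 1 < z j.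
    apply: contrapT => h; apply: nJ; exists (J + K)%N => j Kj.
    by rewrite leNgt; apply/negP => zj; apply: h; exists j.
  exists (j.+1 - J)%N; rewrite subnKC; last by lia.
  rewrite big_nat_recr/=; last by lia.
  rewrite -natr1 min_l ?(ltW zj)// lerD2r; apply: le_trans hK _.
  rewrite [leRHS](big_cat_nat _ (n := (J + K)%N))//=; last by lia.
  by rewrite lerDl sumr_ge0.
have [K hK] := step (Num.truncn T).+1; exists K.
by apply: le_trans hK; exact/ltW/truncnS_gt.
Qed.

Variable psi : nat -> R.
Hypothesis psi2 : forall n, 2 <= psi n.
Hypothesis psi_nd : forall m n, (1 <= m)%N -> (m <= n)%N -> psi m <= psi n.

Lemma weight_ge1 n : 1 <= psi n * ln (psi n).
Proof.
have h := psi2 n; have := @ln2_ge_half R.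
have : ln 2 <= ln (psi n) by rewrite ler_ln ?posrE//; lra.
nra.
Qed.

Lemma weight_nd m n : (1 <= m)%N -> (m <= n)%N ->
  psi m * ln (psi m) <= psi n * ln (psi n).
Proof.
move=> m1 mn; have h := psi2 m; have hn := psi2 n; have hmn := psi_nd m1 mn.
apply: ler_pM => //; try lra; first by apply: ln_ge0; lra.
by rewrite ler_ln ?posrE//; lra.
Qed.

Definition real_term n : R := n%:R / (psi n * ln (psi n)) ^+ 2.
Definition condensed j : R :=
  (4 ^ j)%:R ^+ 2 / (psi (4 ^ j) * ln (psi (4 ^ j))) ^+ 2.

Lemma real_term_ge0 n : 0 <= real_term n.
Proof. by rewrite divr_ge0 ?sqr_ge0. Qed.

Lemma condensed_ge0 j : 0 <= condensed j.
Proof. by rewrite divr_ge0 ?sqr_ge0. Qed.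

(** There are [3 * 4^j] terms with numerator below [4 * 4^j], which gives the constant 12, rounded
    up to 16. *)
Lemma block_le j : \sum_(4 ^ j <= n < 4 ^ j.+1) real_term n <= 16 * condensed j.
Proof.
have p4 : (0 < 4 ^ j)%N by rewrite expn_gt0.
have h0 := weight_ge1 (4 ^ j).
have hq : 0 < (psi (4 ^ j) * ln (psi (4 ^ j))) ^+ 2 by rewrite exprn_gt0//; lra.
apply: (@le_trans _ _ (\sum_(4 ^ j <= n < 4 ^ j.+1)
    (4 ^ j.+1)%:R / (psi (4 ^ j) * ln (psi (4 ^ j))) ^+ 2)).
  rewrite !big_seq; apply: ler_sum => n; rewrite mem_index_iota => /andP[jn nj].
  have hn := weight_nd p4 jn.
  apply: ler_pM => //; first by rewrite invr_ge0 exprn_ge0//; lra.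
    by rewrite ler_nat ltnW.
  by rewrite lef_pV2 ?posrE ?exprn_gt0 ?lerXn2r ?nnegrE//; lra.
rewrite sumr_const_nat -[leLHS]mulr_natl /condensed mulrA mulrA ler_pM2r ?invr_gt0//.
rewrite expnS natrM expr2 natrB; last by lia.
rewrite natrM; have : 0 <= (4 ^ j)%:R :> R by [].
move: (4 ^ j)%:R => c c0; nra.
Qed.

(** The block is closed on the right so that its largest weight is the one at [4^(j+1)]. It has
    [3 * 4^j] terms with numerator at least [4^j], whereas [condensed] has numerator [16 * 16^j]. *)
Lemma block_ge j : condensed j.+1 <= 16 * \sum_((4 ^ j).+1 <=
  n < (4 ^ j.+1).+1) real_term n.
Proof.
have p4 : (0 < 4 ^ j)%N by rewrite expn_gt0.
have h0 := weight_ge1 (4 ^ j.+1).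
have hq : 0 < (psi (4 ^ j.+1) * ln (psi (4 ^ j.+1))) ^+ 2 by rewrite exprn_gt0//; lra.
rewrite -ler_pdivrMl//.
apply: (@le_trans _ _ (\sum_((4 ^ j).+1 <= n < (4 ^ j.+1).+1)
    (4 ^ j)%:R / (psi (4 ^ j.+1) * ln (psi (4 ^ j.+1))) ^+ 2)); last first.
  rewrite !big_seq; apply: ler_sum => n; rewrite mem_index_iota => /andP[jn nj].
  have hn := @weight_nd n (4 ^ j.+1) ltac:(lia) ltac:(lia).
  have hn1 := weight_ge1 n.
  apply: ler_pM => //; first by rewrite invr_ge0 exprn_ge0//; lra.
    by rewrite ler_nat; lia.
  by rewrite lef_pV2 ?posrE ?exprn_gt0 ?lerXn2r ?nnegrE//; lra.
rewrite sumr_const_nat -[leRHS]mulr_natl /condensed mulrA mulrA ler_pM2r ?invr_gt0//.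
rewrite subSS expnS natrB; last by lia.
rewrite !natrM expr2; have : 0 <= (4 ^ j)%:R :> R by [].
move: (4 ^ j)%:R => c c0; nra.
Qed.

Lemma sum_condensed_ge J K :
  \sum_(4 ^ J <= n < 4 ^ (J + K)) real_term n <= 16 * \sum_(J <=
    j < J + K) condensed j.
Proof.
elim: K => [|K IH]; first by rewrite addn0 !big_geq// mulr0.
rewrite addnS (big_cat_nat _ (n := (4 ^ (J + K))%N))/=; last 2 first.
- by rewrite leq_exp2l// leq_addr.
- by rewrite leq_exp2l.
rewrite [X in _ <= 16 * X]big_nat_recr ?leq_addr//= mulrDr.
exact: lerD IH (block_le _).
Qed.

Lemma sum_condensed_le J K :
  \sum_(J <= j < J + K) condensed j.+1 <=
  16 * \sum_((4 ^ J).+1 <= n < (4 ^ (J + K)).+1) real_term n.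
Proof.
elim: K => [|K IH]; first by rewrite addn0 !big_geq// mulr0.
rewrite addnS [X in _ <= 16 * X](big_cat_nat _ (n := (4 ^ (J + K)).+1))/=;
  last 2 first.
- by rewrite ltnS leq_exp2l// leq_addr.
- by rewrite ltnS leq_exp2l.
rewrite big_nat_recr ?leq_addr//= mulrDr.
exact: lerD IH (block_ge _).
Qed.

End condensation.

(** * The zero-one dichotomy *)

Section zero_one.
Variable R : realType.
Implicit Types (x t : R) (S : pred nat) (A B : set R).

Definition prime_above t : pred nat := fun b => prime b && (t <= b%:R).

Lemma prob_prime_le t n A : 2 <= t -> determined n A ->
  prob (A `&` hit n.+1 (prime_above t)) <= 2 * (64 / (t * ln t)) * prob A.
Proof.
move=> t2 dA; apply: prob_hit_le => // M; exact: prime_sq_sum_le.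
Qed.

Lemma prob_prime_ge t n A : 2 <= t -> determined n A ->
  (256 ^+ 2 * (t * ln t))^-1 / 3 * prob A <=
    prob (A `&` hit n.+1 (prime_above t)).
Proof.
move=> t2 dA; have [M hM] := prime_sq_sum_ge t2.
apply: prob_hit_ge hM => //.
by rewrite invr_gt0 !mulr_gt0 ?exprn_gt0// ?ln_gt0//; lra.
Qed.

(** Equivalent to [(1 - c)^M <= 1 / (1 + M c)], a rational substitute for the exponential bound that
    suits an induction on [M]. *)
Lemma one_sub_expr_ge (c : R) M : 0 <= c <= 1 ->
  M%:R * c / (1 + M%:R * c) <= 1 - (1 - c) ^+ M.
Proof.
move=> /andP[c0 c1]; have y0 : 0 <= M%:R * c by rewrite mulr_ge0.
rewrite ler_pdivrMr; last by lra.
suff : (1 - c) ^+ M * (1 + M%:R * c) <= 1 by lra.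
elim: M {y0} => [|M IH]; first by rewrite expr0 mul0r addr0 mulr1.
have r0 : 0 <= (1 - c) ^+ M by rewrite exprn_ge0//; lra.
apply: le_trans IH; rewrite exprSr -mulrA ler_wpM2l//.
have M0 : 0 <= M%:R :> R by [].
rewrite -natr1; move: M%:R M0 => m m0; have : 0 <=
  m * c * c by rewrite !mulr_ge0.
have : 0 <= c * c by rewrite mulr_ge0.
lra.
Qed.

Lemma sqr_ratio_ge (y : R) : 0 <= y -> Num.min 1 (y ^+ 2) / 4 <=
  (y / (1 + y)) ^+ 2.
Proof.
move=> y0; rewrite expr_div_n ler_pdivlMr ?exprn_gt0//; last by lra.
rewrite mulrAC ler_pdivrMr//; have [y1|y1] := leP 1 (y ^+ 2).
  have y1' : 1 <= y by rewrite -(@ler_pXn2r _ 2)// ?nnegrE// expr1n.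
  rewrite !expr2; nra.
have y1' : y <= 1 by rewrite -(@ler_pXn2r _ 2)// ?nnegrE// expr1n ltW.
rewrite ler_wpM2l ?sqr_ge0// !expr2; nra.
Qed.

Variable phi : nat -> R.
Hypothesis phi_pos : forall n, (1 <= n)%N -> 0 < phi n.
Hypothesis phi_nd : forall m n, (1 <= m)%N -> (m <= n)%N -> phi m <= phi n.

(* A prime is at least 2, so [phi] may be replaced by [psi] in the events. *)
Let psi n := Num.max (phi n) 2.

Let psi2 n : 2 <= psi n.
Proof. by rewrite le_max lexx orbT. Qed.

Let psi_nd m n : (1 <= m)%N -> (m <= n)%N -> psi m <= psi n.
Proof. by move=> m1 mn; rewrite ge_max !le_max phi_nd//= lexx orbT. Qed.

Let A n : set R := two_hits n (prime_above (psi n)).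

(** Positivity of [phi n] matters here: it prevents the value 0 assigned to non-prime quotients from
    passing the threshold. *)
Lemma primed_quotientP n k x : (1 <= n)%N ->
  (phi n <= (primed_quotient k x)%:R) = prime_above (psi n) (partial_quotient k x).
Proof.
move=> n1; rewrite /primed_quotient /prime_above; case: ifPn => pp /=.
  by rewrite ge_max (_ : 2 <= _)%R ?andbT// ler_nat prime_gt1.
by apply/negbTE; rewrite -ltNge phi_pos.
Qed.

Lemma two_large_prime_quotientsE :
  two_large_prime_quotients phi = lim_sup_set A.
Proof.
rewrite eqEsubset; split=> x.
  move=> [x01 /infinite_natP h] N _; have [n Nn [k [l [kn ln kl pk pl]]]] :=
    h N.
  exists n => //; split=> //; exists k, l.
  by rewrite -!primed_quotientP//; lia.
move=> h; split; first by have [n _ []] := h 0%N I.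
apply/infinite_natP => N; have [n Nn [_ [k [l [kn ln kl pk pl]]]]] := h N I.
exists n => //; exists k, l.
by rewrite !primed_quotientP//; lia.
Qed.

Let mA n : measurable (A n : set (measurableTypeR R)).
Proof. exact: determined_measurable (determined_two_hits R n _). Qed.

Let mE : measurable (lim_sup_set A : set (measurableTypeR R)).
Proof. by apply: bigcapT_measurable => n; apply: bigcup_measurable. Qed.

Lemma two_hits_mono m n t s : (m <= n)%N -> s <= t ->
  two_hits m (prime_above t) `<=` (two_hits n (prime_above s) : set R).
Proof.
move=> mn st x [x01 [k [l [km lm kl]]]].
rewrite /prime_above => /andP[pk tk] /andP[pl tl]; split=> //; exists k, l.
by split; rewrite ?pk ?pl ?(le_trans st)//; lia.
Qed.

Lemma measure_convergent J0 (T : R) :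
  (forall K, \sum_(J0 <= j < J0 + K) condensed psi j <= T) ->
  lebesgue_measure (two_large_prime_quotients phi) = 0%E.
Proof.
move=> hT; rewrite two_large_prime_quotientsE.
(* For [4^j <= n < 4^(j+1)] the event [A n] lies in [B j], which allows digits up to the right end
   of this range and takes the lower threshold of its left end. *)
pose B j : set R := two_hits (4 ^ j.+1) (prime_above (psi (4 ^ j))).
have mB j : measurable (B j : set (measurableTypeR R)).
  exact: determined_measurable (determined_two_hits R _ _).
pose F i := B (J0 + i)%N.
have F0 : lebesgue_measure (lim_sup_set F) = 0%E.
  apply: lim_sup_set_cvg0 => [k|]; first exact: mB.
  (* With [4^(j+1)] digits and conditional probability at most [128 / w], where [w] is the weight at
     [4^j], two hits have probability at most [(4 * 4^j * 128 / w)^2]. *)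
  apply: (@le_lt_trans _ _ (16 * 128 ^+ 2 * T)%:E); last exact: ltry.
  apply: lime_le; first exact: is_cvg_nneseries.
  apply: nearW => K.
  rewrite (eq_bigr (fun i => (prob (F i))%:E)); last first.
    by move=> i _; exact: probE (determined_two_hits R _ _).
  rewrite sumEFin lee_fin.
  apply: (@le_trans _ _ (16 * 128 ^+ 2 * \sum_(J0 <=
    j < J0 + K) condensed psi j));
    last by rewrite ler_wpM2l.
  rewrite -{1}(add0n J0) big_addn addKn mulr_sumr; apply: ler_sum => i _.
  rewrite /F addnC; set j := (i + J0)%N.
  have h1 := weight_ge1 psi2 (4 ^ j).
  have d0 : 0 <= 2 * (64 / (psi (4 ^ j) * ln (psi (4 ^ j)))) :> R.
    by rewrite mulr_ge0// divr_ge0//; lra.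
  apply: le_trans (prob_two_hits_le _ d0 _) _.
    by move=> m C dC; exact: prob_prime_le.
  rewrite /condensed expnS natrM le_eqVlt; apply/orP; left; apply/eqP.
  move: (psi _ * ln _) h1 {d0} => q h1.
  by field; rewrite gt_eqF//; lra.
apply/eqP; rewrite eq_le measure_ge0 andbT -F0; apply: le_measure;
  rewrite ?inE//.
  by apply: bigcapT_measurable => n; apply: bigcup_measurable => k _; exact: mB.
move=> x h i _; have [n /= in_ An] := h (4 ^ (J0 + i))%N I.
have n0 : (0 < n)%N by apply: leq_trans in_; rewrite expn_gt0.
have /andP[jn nj] := trunc_log_bounds (isT : 1 < 4)%N n0.
have Jj : (J0 + i <= trunc_log 4 n)%N by apply: trunc_log_max.
exists (trunc_log 4 n - J0)%N; first by rewrite /=; lia.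
rewrite /F subnKC; last by lia.
apply: two_hits_mono An; first exact: ltnW.
by apply: psi_nd => //; rewrite expn_gt0.
Qed.

Lemma measure_divergent :
  (forall J (T : R), exists K, T <= \sum_(J <= j < J + K) condensed psi j) ->
  lebesgue_measure (two_large_prime_quotients phi) = 1%E.
Proof.
move=> hd; rewrite two_large_prime_quotientsE.
pose c j : R := (256 ^+ 2 * (psi (4 ^ j.+1) * ln (psi (4 ^ j.+1))))^-1 / 3.
pose F j : set R := hit_twice (prime_above (psi (4 ^ j.+1))) (4 ^ j) (4 ^ j).
pose d j : R := (1 - (1 - c j) ^+ (4 ^ j)) ^+ 2.
have h1 j := weight_ge1 psi2 (4 ^ j.+1).
have c01 j : 0 <= c j <= 1.
  have k1 : 1 <= 256 ^+ 2 :> R by rewrite exprn_ege1// ler1n.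
  have k2 : 1 <= 256 ^+ 2 * (psi (4 ^ j.+1) * ln (psi (4 ^ j.+1))).
    by rewrite -[leLHS]mulr1 ler_pM.
  rewrite /c -invfM invr_ge0 invf_le1; lra.
have hc j m B : determined m B -> c j * prob B <=
    prob (B `&` hit m.+1 (prime_above (psi (4 ^ j.+1)))).
  exact: prob_prime_ge.
have F1 : lebesgue_measure (lim_sup_set F) = 1%E.
  apply: (@measure_lim_sup_determined _ F (fun j => 4 ^ j)%N d).
  - by move=> j; rewrite leq_exp2l.
  - move=> j; apply: determinedW (determined_hit_twice _ _ _ _).
    by rewrite expnS; lia.
  - move=> j; have /andP[c0 c1] := c01 j.
    have r0 : 0 <= (1 - c j) ^+ (4 ^ j) by rewrite exprn_ge0//; lra.
    have r1 : (1 - c j) ^+ (4 ^ j) <= 1 by rewrite exprn_ile1//; lra.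
    by rewrite /d sqr_ge0 exprn_ile1//; lra.
  - by move=> j B dB; apply: prob_hit_twice (dB) => //; exact: hc.
  (* Chosen so that [k * condensed psi j.+1 = (4^j * c j)^2]: the 16 offsets the shift from [4^j] to
     [4^(j+1)], and [3 * 256^2] is the constant in [c j]. *)
  pose k : R := (16 * (3 * 256 ^+ 2) ^+ 2)^-1.
  have k0 : 0 < k by rewrite invr_gt0 mulr_gt0// exprn_gt0// mulr_gt0// exprn_gt0.
  pose z j := k * condensed psi j.+1.
  have zd J T : exists K, T <= \sum_(J <= j < J + K) Num.min 1 (z j).
    apply: sum_min1_unbounded => [j|{}J {}T];
      first by rewrite mulr_ge0 ?condensed_ge0// ltW.
    have [K hK] := hd J.+1 (T / k); exists K.
    by rewrite -mulr_sumr mulrC -ler_pdivrMr//; move: hK;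
      rewrite big_add1 addSn.
  move=> J T; have [K hK] := zd J (4 * T); exists K.
  rewrite -ler_pdivlMl// in hK; apply: le_trans hK _.
  rewrite mulr_sumr; apply: ler_sum => j _.
  have /andP[c0 c1] := c01 j.
  have y0 : 0 <= (4 ^ j)%:R * c j by rewrite mulr_ge0.
  have := one_sub_expr_ge (4 ^ j) (c01 j) => hy.
  apply: (@le_trans _ _ (((4 ^ j)%:R * c j / (1 + (4 ^ j)%:R * c j)) ^+ 2));
    last first.
    by rewrite /d lerXn2r ?nnegrE ?divr_ge0//; try lra; apply: le_trans hy;
      rewrite divr_ge0//; lra.
  apply: le_trans (sqr_ratio_ge y0); rewrite mulrC.
  rewrite (_ : z j = ((4 ^ j)%:R * c j) ^+ 2)//.
  rewrite /z /k /condensed /c; move: (psi _ * ln _) (h1 j) => q q1.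
  have p0 : 0 < 256 ^+ 2 :> R by rewrite exprn_gt0.
  rewrite expnS natrM; move: (256 ^+ 2) p0 (4 ^ j)%:R => p p0 m.
  by field; rewrite !gt_eqF//; lra.
apply/eqP; rewrite eq_le; apply/andP; split.
  rewrite -(measure01 R); apply: le_measure; rewrite ?inE//.
    exact: determined_measurable (determined01 R 0).
  by move=> x h; have [n _ []] := h 0%N I.
rewrite -F1; apply: le_measure; rewrite ?inE//.
  apply: bigcapT_measurable => n; apply: bigcup_measurable => k _.
  exact: determined_measurable (determined_hit_twice _ _ _ _).
move=> x h N _; have [j /= Nj [x01 [m1 m2]]] := h N I.
exists (4 ^ j.+1)%N => /=.
  by have := ltn_expl j.+1 (isT : (1 < 4)%N); lia.
have get n M S : ~ miss n M S x -> exists2 k, (n < k <=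
  n + M)%N & S (partial_quotient k x).
  move=> nm; apply: contrapT => h'; apply: nm; split=> // k kn.
  by apply/negP => Sk; apply: h'; exists k.
have [k k1 Sk] := get _ _ _ m1; have [l l1 Sl] := get _ _ _ m2.
have e4 : (4 ^ j.+1 = 4 * 4 ^ j)%N by rewrite expnS.
split=> //; exists k, l; split=> //; lia.
Qed.

Let termE n : 2 <= phi n -> series_term phi n = (real_term psi n)%:E.
Proof.
move=> p2; rewrite series_termE; [|lra|by move=> p1; move: p2; rewrite p1; lra].
by rewrite /real_term /psi max_l// exprMn.
Qed.

(** The inequalities [x - 1 <= x ln x <= x (x - 1)] confine [x ln x] to the interval (-1, 2). *)
Let sqr_xlnx_le x : 0 < x < 2 -> x ^+ 2 * ln x ^+ 2 <= 4.
Proof.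
move=> /andP[x0 x2]; rewrite -exprMn.
have u : ln x <= x - 1.
  by have := @le_ln1Dx R (x - 1); rewrite subrKC; apply; lra.
have l : 1 - x^-1 <= ln x.
  have := @le_ln1Dx R (x^-1 - 1); rewrite subrKC lnV ?posrE//.
  have : 0 < x^-1 by rewrite invr_gt0.
  move=> xi h; have := h ltac:(lra); lra.
have : x * (1 - x^-1) <= x * ln x by rewrite ler_pM2l.
rewrite mulrBr mulr1 divff ?gt_eqF// => l'.
have u' : x * ln x <= x * (x - 1) by rewrite ler_pM2l.
have hi : x * ln x <= 2 by nra.
rewrite expr2; nra.
Qed.

(** If [phi] stays below 2, [psi] is constant and carries no information about the series; but then
    every term is at least 1/4, being infinite where [phi n = 1]. *)
Let divergent_of_lt2 : (forall n, (1 <= n)%N -> phi n < 2) ->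
  ~ series_convergent phi.
Proof.
move=> p2 [N N0]; apply/negP; rewrite -leNgt leye_eq; apply/eqP/eqyP => T T0.
have term_ge n : (1 <= n)%N -> (4^-1%:E <= series_term phi n)%E.
  move=> n1; have n1' : 1 <= n%:R :> R by rewrite ler1n.
  have [p1|p1] := eqVneq (phi n) 1.
    rewrite /series_term p1 ln1 expr0n mulr0 inver eqxx mulry gtr0_sg ?mul1e ?leey//.
    by rewrite ltr0n.
  rewrite series_termE ?phi_pos//; last exact/eqP.
  have := @sqr_xlnx_le (phi n); rewrite phi_pos// p2// => /(_ isT) le4.
  have gt0 : 0 < phi n ^+ 2 * ln (phi n) ^+ 2.
    by rewrite lt_neqAle mulr_ge0 ?sqr_ge0// andbT eq_sym mulf_neq0// expf_neq0//
       ?ln_eq0 ?phi_pos// gt_eqF// phi_pos.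
  rewrite lee_fin ler_pdivlMr//; lra.
pose K := (4 * (Num.truncn T).+1)%N.
apply: (@le_trans _ _ (\sum_(N <= n < N + K) series_term phi n)%E); last first.
  by apply: nneseries_lim_ge => n _ _; exact: series_term_ge0.
apply: (@le_trans _ _ (\sum_(N <= n < N + K) 4^-1%:E)%E).
  rewrite sumEFin sumr_const_nat addKn lee_fin -[leRHS]mulr_natr natrM.
  by have := truncnS_gt T; lra.
rewrite !big_seq; apply: lee_sum => n; rewrite mem_index_iota => nr.
by apply: term_ge; lia.
Qed.

Let ge2_cases : (exists2 N0, (1 <= N0)%N & forall n, (N0 <= n)%N -> 2 <=
  phi n) \/
  (forall n, (1 <= n)%N -> phi n < 2).
Proof.
have [[N0 N1 p2]|np] := pselect (exists2 N0, (1 <= N0)%N & 2 <= phi N0).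
  by left; exists N0 => // n Nn; apply: le_trans p2 _; exact: phi_nd.
by right=> n n1; rewrite ltNge; apply/negP => p2; apply: np; exists n.
Qed.

Lemma measure_series_convergent : series_convergent phi ->
  lebesgue_measure (two_large_prime_quotients phi) = 0%E.
Proof.
move=> cvg; have [[N0 N1 p2]|p2] := ge2_cases; last by have :=
  divergent_of_lt2 p2 cvg.
have [N NN fin] := cvg.
have fin' : (\sum_(N <= n <oo) series_term phi n)%E \is a fin_num.
  by rewrite ge0_fin_numE// nneseries_ge0// => n _ _; exact: series_term_ge0.
(* Beyond [4^J] all indices lie in the convergent tail and satisfy [phi n >= 2], so that [psi]
   agrees with [phi] there. *)
pose J := maxn N N0.
have JJ : (maxn N N0 < 4 ^ J)%N by exact: ltn_expl.
apply: (@measure_convergent J.+1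
   (16 * fine (\sum_(N <= n <oo) series_term phi n)%E)) => K.
rewrite addSn big_add1 /=.
apply: le_trans (sum_condensed_le psi2 psi_nd J K) _.
rewrite ler_pM2l// -lee_fin fineK//.
apply: (@le_trans _ _ (\sum_((4 ^ J).+1 <=
  n < (4 ^ (J + K)).+1) series_term phi n)%E).
  rewrite -sumEFin !big_seq; apply: lee_sum => n; rewrite mem_index_iota => nr.
  by rewrite termE// p2//; lia.
apply: le_trans (nneseries_lim_ge (4 ^ (J + K)).+1 _); last first.
  by move=> n _ _; exact: series_term_ge0.
rewrite [leRHS](big_cat_nat _ (n := (4 ^ J).+1))/=; [|lia|]; last first.
  by rewrite ltnS leq_exp2l// leq_addr.
by rewrite leeDr// sume_ge0// => n _; exact: series_term_ge0.
Qed.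

Lemma measure_series_divergent : series_divergent phi ->
  lebesgue_measure (two_large_prime_quotients phi) = 1%E.
Proof.
move=> div; apply: measure_divergent => J T.
have [[N0 N1 p2]|p2] := ge2_cases; last first.
  (* Here [psi] is constantly 2, and each condensed term is at least [1 / (2 ln 2)^2 >= 1/4]. *)
  exists (4 * (Num.truncn T).+1)%N.
  apply: (@le_trans _ _ (\sum_(J <= j < J + 4 * (Num.truncn T).+1) 4^-1)).
    rewrite sumr_const_nat addKn -[leRHS]mulr_natr natrM.
    have := truncnS_gt T; lra.
  rewrite !big_seq; apply: ler_sum => j _.
  have p4 : (1 <= 4 ^ j)%N by rewrite expn_gt0.
  have p4' : 1 <= (4 ^ j)%:R :> R by rewrite ler1n.
  rewrite /condensed /psi max_r ?(ltW (p2 _ p4))//.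
  have := @ln2_ge_half R; have : ln 2 <= 1 :> R.
    by have := @le_ln1Dx R 1; rewrite (_ : 1 + 1 = 2)//; apply; lra.
  move=> u l; rewrite ler_pdivlMr ?exprn_gt0//; last by lra.
  rewrite !expr2; nra.
pose J1 := maxn J N0.
have JJ : (J1 < 4 ^ J1)%N by exact: ltn_expl.
(* Otherwise the partial sums from [4^J1] on would be bounded, against the divergence of every
   tail. *)
have [M hM] : exists M, 16 * T <= \sum_(4 ^ J1 <= n < M) real_term psi n.
  apply: contrapT => nM.
  have := div (4 ^ J1)%N ltac:(lia).
  suff : (\sum_(4 ^ J1 <= n <oo) series_term phi n <= (16 * T)%:E)%E.
    by move=> + h; rewrite h leye_eq.
  apply: lime_le.
    by apply: is_cvg_nneseries => n _ _; exact: series_term_ge0.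
  apply: nearW => M.
  rewrite big_seq (eq_bigr (fun n => (real_term psi n)%:E)); last first.
    by move=> n; rewrite mem_index_iota => nr; rewrite termE// p2//; lia.
  rewrite -big_seq sumEFin lee_fin leNgt; apply/negP => h.
  by apply: nM; exists M; exact: ltW.
exists (J1 - J + M)%N.
(* A crude choice: [M] further condensed terms cover all the indices below [M]. *)
have M4 : (M <= 4 ^ (J1 + M))%N.
  by apply: leq_trans (ltnW (ltn_expl M (isT : (1 < 4)%N))) _;
    rewrite leq_exp2l// leq_addl.
have -> : (J + (J1 - J + M) = J1 + M)%N by lia.
rewrite (big_cat_nat _ (n := J1))/=; [|lia|lia].
rewrite -[leLHS]add0r lerD ?sumr_ge0// => [j _|]; first exact: condensed_ge0.
rewrite -(@ler_pM2l _ 16)//;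
  apply: le_trans (sum_condensed_ge psi2 psi_nd J1 M).
apply: le_trans hM _; have [Ml|Ml] := leqP (4 ^ J1) M.
  rewrite [leRHS](big_cat_nat _ (n := M))//= lerDl sumr_ge0// => n _.
  exact: real_term_ge0.
by rewrite big_geq ?(ltnW Ml)// sumr_ge0// => n _; exact: real_term_ge0.
Qed.

End zero_one.

Theorem theorem1 (R : realType) (phi : nat -> R)
  (phi_pos : forall n : nat, (1 <= n)%N -> 0 < phi n)
  (phi_nd : forall m n : nat, (1 <= m)%N -> (m <= n)%N -> phi m <= phi n) :
  (series_convergent phi ->
     lebesgue_measure (two_large_prime_quotients phi) = 0%E) /\
  (series_divergent phi ->
     lebesgue_measure (two_large_prime_quotients phi) = 1%E).
Proof.
by split; [exact: measure_series_convergent|exact: measure_series_divergent].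
Qed.
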